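(* Let $L/F$ be a finite extension of number fields, let $\widehat{L}$ be the normal closure of $L$ over $F$, let $G=\operatorname{Gal}(\widehat{L}/F)$, let $n$ be a positive integer and let $p$ be a prime coprime to $[L:F]$. Suppose that $G$ is not isomorphic to a quotient of any subgroup of $\operatorname{GL}_2(\mathbb{Z}/p^n\mathbb{Z})$ and that $\operatorname{Gal}(\widehat{L}/L)$ is a maximal subgroup of $G$. Let $E/F$ be an elliptic curve that has an $F$-rational point of order $p^n$, but no $F$-rational point of order $p^{n+1}$. Then $E(L)$ has no points of order $p^{n+1}$. *)

(* Defs.v *)
From HB Require Import structures.
From mathcomp Require Import all_boot all_order all_algebra.
From mathcomp Require Import all_fingroup all_solvable all_field.

Set Implicit Arguments.
Unset Strict Implicit.
Unset Printing Implicit Defensive.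

Import GRing.Theory.
Local Open Scope ring_scope.

(* The cubic y^2 + a1 x y + a3 y = x^3 + a2 x^2 + a4 x + a6. *)
Record weierstrass (K : Type) :=
  Weierstrass { wa1 : K; wa2 : K; wa3 : K; wa4 : K; wa6 : K }.

Definition map_weierstrass (K K' : Type) (f : K -> K') (E : weierstrass K) :=
  Weierstrass (f (wa1 E)) (f (wa2 E)) (f (wa3 E)) (f (wa4 E)) (f (wa6 E)).

Section Weierstrass.

Variables (K : fieldType) (E : weierstrass K).

Let a1 := wa1 E.
Let a2 := wa2 E.
Let a3 := wa3 E.
Let a4 := wa4 E.
Let a6 := wa6 E.

Definition discriminant : K :=
  let b2 := a1 ^+ 2 + 4 * a2 in
  let b4 := 2 * a4 + a1 * a3 in
  let b6 := a3 ^+ 2 + 4 * a6 in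
  let b8 := a1 ^+ 2 * a6 + 4 * a2 * a6 - a1 * a3 * a4 + a2 * a3 ^+ 2
            - a4 ^+ 2 in
  - (b2 ^+ 2 * b8) - 8 * b4 ^+ 3 - 27 * b6 ^+ 2 + 9 * b2 * b4 * b6.

Definition elliptic : bool := discriminant != 0.

(* None is the point at infinity, Some (x, y) an affine point. *)
Definition on_curve (P : option (K * K)) : bool :=
  if P is Some (x, y) then
    y ^+ 2 + a1 * x * y + a3 * y == x ^+ 3 + a2 * x ^+ 2 + a4 * x + a6
  else true.

(* The chord-and-tangent law; it is meaningful only for points satisfying
   on_curve. In the last case y = l x + m is the chord through the two points,
   or the tangent if they coincide. *)
Definition ec_add (P Q : option (K * K)) : option (K * K) :=
  match P, Q with
  | None, _ => Q
  | _, None => P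
  | Some (x1, y1), Some (x2, y2) =>
    if (x1 == x2) && (y1 + y2 + a1 * x2 + a3 == 0) then None else
    let l := if x1 == x2 then
               (3 * x1 ^+ 2 + 2 * a2 * x1 + a4 - a1 * y1)
                 / (2 * y1 + a1 * x1 + a3)
             else (y2 - y1) / (x2 - x1) in
    let m := y1 - l * x1 in
    let x3 := l ^+ 2 + a1 * l - a2 - x1 - x2 in
    Some (x3, - (l + a1) * x3 - m - a3)
  end.

Definition ec_mul (k : nat) (P : option (K * K)) : option (K * K) :=
  iter k (ec_add P) None.

Definition has_point_of_order (m : nat) : Prop :=
  exists P : option (K * K),
    [/\ on_curve P, (0 < m)%N, ec_mul m P = None
      & forall k : nat, (0 < k < m)%N -> ec_mul k P <> None].

End Weierstrass.

(* As a splittingFieldType, N is already finite and normal over F; what remains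
   is that no proper intermediate field containing L is normal over F. *)
Definition is_normal_closure (F : fieldType) (L : fieldExtType F)
    (N : splittingFieldType F) (iota : 'AHom(L, N)) : Prop :=
  forall M : {subfield N},
    (limg iota <= M)%VS -> normalField 1 M -> M = {:N}%VS :> {vspace N}.

(* Main.v *)
Require Import Defs.
From HB Require Import structures.
From mathcomp Require Import all_boot all_order all_algebra.
From mathcomp Require Import all_fingroup all_solvable all_field.
From mathcomp Require Import boolp ring zify.

(** Let Q be a point of order p^(n+1) over L, seen in the normal closure N, and
    let G = Gal(N/F), H = Gal(N/L). The stabilizer of Q in G contains H and is
    not G, so by maximality it is H. Let V be the subgroup of G fixing the
    p^n-torsion of E(N) pointwise. If s is in V and R is killed by p^(n+1), then
    s R - R is p-torsion, so fixed by s, and s^p R = R; hence s^p lies in the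
    normal subgroup fixing the p^(n+1)-torsion, which is contained in H and so
    trivial, N being the normal closure. Thus V is a normal p-group; as [L:F]
    is prime to p it lies in H, and V = 1 for the same reason. So G acts
    faithfully on B = E(N)[p^n]. As E(N)[p] has fewer than p^3 points, B is
    generated by the rational point P of order p^n and one further point, and
    every element of G acts on these generators through an invertible matrix
    modulo p^n, which makes G a quotient of a subgroup of GL_2(Z/p^n).

    The group law comes from the classes of ideals in the coordinate ring: the
    ideal I_P of P satisfies I_P I_Q ~ I_(P+Q), and I_P is not principal for P
    affine because no function has a norm of degree 1. The bound on the
    p-torsion comes from the polynomials computing the abscissa of m P. *)

Set Implicit Arguments.
Unset Strict Implicit.
Unset Printing Implicit Defensive.

Import GRing.Theory.
Local Open Scope ring_scope.

(** * Products of ideals and the coordinate ring *)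

Section IdealProduct.

Variable R : comNzRingType.
Implicit Types (I J : R -> Prop) (f g : R).

(** Ideals are plain predicates and a product consists of finite sums of products, so that the
    product laws below become equalities usable for rewriting. *)
Inductive ideal_mul I J : R -> Prop :=
| ideal_mul0 : ideal_mul I J 0
| ideal_mulD f g h : I f -> J g -> ideal_mul I J h -> ideal_mul I J (f * g + h).

Definition principal f : R -> Prop := fun g => exists h, g = f * h.

Lemma ideal_mulM I J f g : I f -> J g -> ideal_mul I J (f * g).
Proof. by move=> If Jg; rewrite -[_ * _]addr0; apply: ideal_mulD => //;
  left. Qed.

Lemma ideal_mul_add I J f g :
  ideal_mul I J f -> ideal_mul I J g -> ideal_mul I J (f + g).
Proof.
move=> IJf IJg; elim: f / IJf => [|f1 f2 f3 If1 Jf2 _ IH];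
  first by rewrite add0r.
by rewrite -addrA; apply: ideal_mulD.
Qed.

Lemma ideal_mul_sub I J (C : R -> Prop) :
    C 0 -> (forall f g, C f -> C g -> C (f + g)) ->
    (forall f g, I f -> J g -> C (f * g)) ->
  forall f, ideal_mul I J f -> C f.
Proof.
by move=> C0 CD CM f; elim=> // g h k Ig Jh _ Ck; apply: CD => //; apply: CM.
Qed.

Lemma ideal_mulC I J : ideal_mul I J = ideal_mul J I.
Proof.
apply/predeqP => f; split; apply: ideal_mul_sub => {f}; try by [left];
  try exact: ideal_mul_add.
- by move=> f g If Jg; rewrite mulrC; apply: ideal_mulM.
- by move=> f g If Jg; rewrite mulrC; apply: ideal_mulM.
Qed.

Lemma ideal_mulA I J K :
  ideal_mul I (ideal_mul J K) = ideal_mul (ideal_mul I J) K.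
Proof.
apply/predeqP => f; split; apply: ideal_mul_sub => {f}; try by [left];
  try exact: ideal_mul_add.
- move=> f g If; move: g; apply: ideal_mul_sub => [|g h|g h Jg Kh].
  + by rewrite mulr0; left.
  + by rewrite mulrDr; apply: ideal_mul_add.
  + by rewrite mulrA; do 2!apply: ideal_mulM => //.
- move=> f g + Kg; move: f; apply: ideal_mul_sub => [|f h|f h If Jh].
  + by rewrite mul0r; left.
  + by rewrite mulrDl; apply: ideal_mul_add.
  + by rewrite -mulrA; do 2!apply: ideal_mulM => //.
Qed.

Lemma ideal_mulCA I J K :
  ideal_mul I (ideal_mul J K) = ideal_mul J (ideal_mul I K).
Proof. by rewrite ideal_mulA (ideal_mulC I) -ideal_mulA. Qed.

Lemma ideal_mulACA I J K L :
  ideal_mul (ideal_mul I J) (ideal_mul K L) =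
  ideal_mul (ideal_mul I K) (ideal_mul J L).
Proof. by rewrite -!ideal_mulA (ideal_mulCA J). Qed.

Lemma principal_mul f g :
  ideal_mul (principal f) (principal g) = principal (f * g).
Proof.
apply/predeqP => h; split=> [|[k ->]].
  move: h; apply: ideal_mul_sub => [|_ _ [h ->] [k ->]|_ _ [h ->] [k ->]].
  - by exists 0; rewrite mulr0.
  - by exists (h + k); rewrite mulrDr.
  - by exists (h * k); rewrite mulrACA.
by rewrite -mulrA; apply: ideal_mulM; [exists 1; rewrite mulr1|exists k].
Qed.

Definition is_ideal I :=
  [/\ I 0, forall f g, I f -> I g -> I (f + g) & forall f g, I f -> I (f * g)].

Lemma principal_ideal f : is_ideal (principal f).
Proof.
split=> [|_ _ [h ->] [k ->]|_ g [h ->]]; first by exists 0; rewrite mulr0.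
  by exists (h + k); rewrite mulrDr.
by exists (h * g); rewrite mulrA.
Qed.

Lemma ideal_mul_ideal I J : is_ideal J -> is_ideal (ideal_mul I J).
Proof.
case=> _ _ JM; split=> [|f g|f g]; [by left | exact: ideal_mul_add|].
move: f; apply: ideal_mul_sub => [|f h|f h If Jh]; first by rewrite mul0r; left.
  by rewrite mulrDl; apply: ideal_mul_add.
by rewrite -mulrA; apply: ideal_mulM => //; apply: JM.
Qed.

Lemma principal1_mul I : is_ideal I -> ideal_mul (principal 1) I = I.
Proof.
case=> I0 ID IM; apply/predeqP => h; split=> [|Ih].
  move: h; apply: ideal_mul_sub => // _ g [f ->] Ig.
  by rewrite mul1r mulrC; apply: IM.
by rewrite -[h]mul1r; apply: ideal_mulM => //; exists 1; rewrite mul1r.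
Qed.

Lemma principal_mulP f I g : is_ideal I ->
  ideal_mul (principal f) I g <-> exists2 h, I h & g = f * h.
Proof.
case=> I0 ID IM; split=> [|[h Ih ->]].
  move: g; apply: ideal_mul_sub => [|_ _ [g Ig ->] [h Ih ->]|_ h [g ->] Ih].
  - by exists 0; rewrite ?mulr0.
  - by exists (g + h); rewrite ?mulrDr//; apply: ID.
  - by exists (h * g); [apply: IM | rewrite -mulrA (mulrC g)].
by apply: ideal_mulM => //; exists 1; rewrite mulr1.
Qed.

End IdealProduct.

Section CoordinateRing.

Variables (K : fieldType) (E : weierstrass K).

Definition wlin : {poly K} := (wa1 E)%:P * 'X + (wa3 E)%:P.
Definition wcub : {poly K} :=
  'X ^+ 3 + (wa2 E)%:P * 'X ^+ 2 + (wa4 E)%:P * 'X + (wa6 E)%:P.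

End CoordinateRing.

(* The pair (a, b) stands for a(X) + b(X) Y in K[X, Y] / (curve equation). *)
Definition coord_ring (K : fieldType) (E : weierstrass K) : Type :=
  ({poly K} * {poly K})%type.

HB.instance Definition _ (K : fieldType) (E : weierstrass K) :=
  GRing.Zmodule.copy (coord_ring E) ({poly K} * {poly K})%type.

Section CoordRingStructure.

Variables (K : fieldType) (E : weierstrass K).

Definition coord_one : coord_ring E := (1, 0).
(** The equation of the curve replaces Y^2 by [wcub E] - [wlin E] Y. *)
Definition coord_mul (f g : coord_ring E) : coord_ring E :=
  (f.1 * g.1 + f.2 * g.2 * wcub E,
   f.1 * g.2 + f.2 * g.1 - f.2 * g.2 * wlin E).

Fact coord_mulA : associative coord_mul.
Proof. by move=> [? ?] [? ?] [? ?]; rewrite /coord_mul/=; congr pair; ring. Qed.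

Fact coord_mulC : commutative coord_mul.
Proof. by move=> [? ?] [? ?]; rewrite /coord_mul/=; congr pair; ring. Qed.

Fact coord_mul1 : left_id coord_one coord_mul.
Proof. by move=> [? ?]; rewrite /coord_mul/=; congr pair; ring. Qed.

Fact coord_mulD : left_distributive coord_mul +%R.
Proof.
move=> [? ?] [? ?] [? ?]; rewrite /coord_mul /=.
by apply/eqP; rewrite xpair_eqE /=; apply/andP; split; apply/eqP; ring.
Qed.

Fact coord_one_neq0 : coord_one != 0.
Proof. by apply/eqP => -[/eqP]; rewrite oner_eq0. Qed.

HB.instance Definition _ := GRing.Zmodule_isComNzRing.Build (coord_ring E)
  coord_mulA coord_mulC coord_mul1 coord_mulD coord_one_neq0.

End CoordRingStructure.

Section CoordinateRingTheory.

Variables (K : fieldType) (E : weierstrass K).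
Implicit Types (f g : coord_ring E).

Definition coord_poly (a : {poly K}) : coord_ring E := (a, 0).
Definition coord_eval (x y : K) f : K := f.1.[x] + f.2.[x] * y.
(* The conjugation is Y |-> - Y - a1 X - a3. *)
Definition coord_conj f : coord_ring E := (f.1 - f.2 * wlin E, - f.2).
Definition coord_norm f : {poly K} :=
  f.1 ^+ 2 - f.1 * f.2 * wlin E - f.2 ^+ 2 * wcub E.

Lemma coord_mulE f g : f * g =
  (f.1 * g.1 + f.2 * g.2 * wcub E,
   f.1 * g.2 + f.2 * g.1 - f.2 * g.2 * wlin E).
Proof. by []. Qed.

Lemma coord_addE f g : f + g = (f.1 + g.1, f.2 + g.2).
Proof. by []. Qed.

Lemma coord_oppE f : - f = (- f.1, - f.2).
Proof. by []. Qed.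

Lemma coord_eqP f g : f.1 = g.1 -> f.2 = g.2 -> f = g.
Proof. by case: f g => [? ?] [? ?] /= -> ->. Qed.

Lemma coord_mul_conj f : f * coord_conj f = coord_poly (coord_norm f).
Proof. by apply: coord_eqP; rewrite /= /coord_norm; ring. Qed.

Lemma coord_normM f g : coord_norm (f * g) = coord_norm f * coord_norm g.
Proof. by case: f g => [? ?] [? ?]; rewrite /coord_norm coord_mulE /=;
  ring. Qed.

Lemma coord_polyM a b : coord_poly (a * b) = coord_poly a * coord_poly b.
Proof. by apply: coord_eqP => /=; ring. Qed.

Lemma coord_poly_neq0 a : a != 0 -> coord_poly a != 0.
Proof. by apply: contra => /eqP -[->]. Qed.

Lemma size_wlin : (size (wlin E) <= 2)%N.
Proof.
rewrite /wlin (leq_trans (size_polyD _ _)) // geq_max.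
rewrite (leq_trans (size_polyC_leq1 _)) // andbT mul_polyC.
by rewrite (leq_trans (size_scale_leq _ _)) // size_polyX.
Qed.

Lemma size_wcub : size (wcub E) = 4.
Proof.
rewrite /wcub -!addrA size_polyDl size_polyXn // !mul_polyC ltnS.
rewrite (leq_trans (size_polyD _ _)) // geq_max.
rewrite (leq_trans (size_scale_leq _ _)) ?size_polyXn //=.
rewrite (leq_trans (size_polyD _ _)) // geq_max.
rewrite (leq_trans (size_scale_leq _ _)) ?size_polyX //=.
by rewrite (leq_trans (size_polyC_leq1 _)).
Qed.

(** For f = a + b Y the terms a^2 and b^2 [wcub E] have degrees 2 deg a and 2 deg b + 3, of
    different parity, and the cross term a b [wlin E] stays below the larger one; so nothing cancels
    in top degree. *)
Lemma size_coord_norm f :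
  size (coord_norm f) =
    maxn (size f.1).*2.-1 (if f.2 == 0 then 0 else (size f.2).*2.+2).
Proof.
case: f => [a b]; rewrite /coord_norm /=.
have sq (c : {poly K}) : c != 0 -> size (c ^+ 2) = (size c).*2.-1.
  by move=> c0; rewrite expr2 size_mul // addnn.
have cub0 : wcub E != 0 by rewrite -size_poly_gt0 size_wcub.
case: (eqVneq b 0) => [->|b0].
  rewrite maxn0 mulr0 expr0n /= !mul0r !subr0.
  by case: (eqVneq a 0) => [->|/sq //]; rewrite expr0n size_poly0.
have sb : (0 < size b)%N by rewrite size_poly_gt0.
have sbc : size (b ^+ 2 * wcub E) = (size b).*2.+2.
  by rewrite size_mul ?expf_neq0 // sq // size_wcub; lia.
case: (eqVneq a 0) => [->|a0].
  by rewrite expr0n /= !mul0r subr0 add0r size_polyN sbc size_poly0 /= max0n.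
have sa : (0 < size a)%N by rewrite size_poly_gt0.
have sab : (size (a * b * wlin E)%R <= size a + size b)%N.
  apply: leq_trans (size_polyMleq _ _) _; rewrite -subn1 leq_subLR.
  apply: leq_trans (leq_add (size_polyMleq a b) size_wlin) _.
  by move: (size a) (size b) sa sb => m k; lia.
case: (leqP (size a) (size b).+1) => cab.
  rewrite addrC size_polyDl size_polyN sbc.
    by move: (size a) (size b) sa sb cab => m k *; lia.
  rewrite (leq_ltn_trans (size_polyD _ _)) // gtn_max sq // size_polyN.
  apply/andP; split; first by move: (size a) (size b) sa sb cab => m k *; lia.
  apply: leq_ltn_trans sab _.
  by move: (size a) (size b) sa sb cab => m k *; lia.
rewrite -addrA -opprD size_polyDl sq //.
  by move: (size a) (size b) sa sb cab => m k *; lia.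
rewrite size_polyN (leq_ltn_trans (size_polyD _ _)) // gtn_max sbc.
apply/andP; split; last by move: (size a) (size b) sa sb cab => m k *; lia.
apply: leq_ltn_trans sab _.
by move: (size a) (size b) sa sb cab => m k *; lia.
Qed.

(** With multiplicativity of the norm, this makes the coordinate ring a domain. *)
Lemma coord_norm_eq0 f : (coord_norm f == 0) = (f == 0).
Proof.
rewrite -size_poly_eq0 size_coord_norm; case: f => [a b] /=.
rewrite [RHS]xpair_eqE; case: (eqVneq b 0) => [_|_]; last by rewrite andbF; lia.
by rewrite andbT maxn0 -[RHS]size_poly_eq0; case: (size a) => [|m];
  rewrite ?doubleS.
Qed.

Lemma coord_mulf_eq0 f g : (f * g == 0) = (f == 0) || (g == 0).
Proof. by rewrite -!coord_norm_eq0 coord_normM mulf_eq0. Qed.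

Lemma coord_mulfI f : f != 0 -> injective ( *%R f).
Proof.
move=> f0 g h /eqP; rewrite -subr_eq0 -mulrBr coord_mulf_eq0 (negPf f0) /=.
by rewrite subr_eq0 => /eqP.
Qed.

Lemma coord_evalD x y f g :
  coord_eval x y (f + g) = coord_eval x y f + coord_eval x y g.
Proof. by rewrite /coord_eval /= !hornerD; ring. Qed.

Lemma wcub_on_curve x y : on_curve E (Some (x, y)) ->
  (wcub E).[x] = y ^+ 2 + wa1 E * x * y + wa3 E * y.
Proof. by move/eqP => ->; rewrite /wcub !hornerE; ring. Qed.

Lemma coord_evalM x y f g : on_curve E (Some (x, y)) ->
  coord_eval x y (f * g) = coord_eval x y f * coord_eval x y g.
Proof.
move/wcub_on_curve; rewrite /coord_eval coord_mulE /=.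
by move: (wcub E) => c Ec; rewrite !hornerE Ec ; ring.
Qed.

(** The point at infinity is not on the affine curve; its ideal is the whole ring, which represents
    the trivial class. *)
Definition point_ideal (P : option (K * K)) : coord_ring E -> Prop :=
  if P is Some (x, y) then fun f => coord_eval x y f = 0 else fun=> True.

Lemma point_ideal_ideal P : on_curve E P -> is_ideal (point_ideal P).
Proof.
case: P => [[x y]|] // Exy; rewrite /point_ideal; split.
- by rewrite /coord_eval /= !hornerE; ring.
- by move=> f g f0 g0; rewrite coord_evalD f0 g0 addr0.
- by move=> f g f0; rewrite coord_evalM // f0 mul0r.
Qed.

Lemma point_ideal0 : point_ideal None = principal 1.
Proof. by apply/predeqP => f; split=> // _; exists f; rewrite mul1r. Qed.

Definition ec_opp (P : option (K * K)) : option (K * K) :=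
  if P is Some (x, y) then Some (x, - y - wa1 E * x - wa3 E) else None.

Lemma ec_oppK : involutive ec_opp.
Proof. by case=> [[x y]|] //=; congr (Some (_, _)); ring. Qed.

Lemma on_curve_opp P : on_curve E (ec_opp P) = on_curve E P.
Proof.
case: P => [[x y]|] //=; congr (_ == _); ring.
Qed.

End CoordinateRingTheory.

(** * Ideal classes of the coordinate ring *)

Section IdealClasses.

Variables (K : fieldType) (E : weierstrass K).
Implicit Types (I J : coord_ring E -> Prop) (f g u v : coord_ring E).

(** Equality in the ideal class group, with denominators cleared to avoid fractional ideals. *)
Definition ideal_equiv I J := exists u v,
  [/\ u != 0, v != 0 & ideal_mul (principal u) I = ideal_mul (principal v) J].

Lemma ideal_equiv_refl I : ideal_equiv I I.
Proof. by exists 1, 1; split=> //; apply: oner_neq0. Qed.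

Lemma ideal_equiv_sym I J : ideal_equiv I J -> ideal_equiv J I.
Proof. by case=> u [v [u0 v0 IJ]]; exists v, u; split. Qed.

Lemma ideal_equiv_trans J I L :
  ideal_equiv I J -> ideal_equiv J L -> ideal_equiv I L.
Proof.
move=> [u [v [u0 v0 IJ]]] [u' [v' [u'0 v'0 JL]]]; exists (u' * u), (v * v').
rewrite !coord_mulf_eq0 !negb_or u0 v0 u'0 v'0; split=> //.
by rewrite -!principal_mul -!ideal_mulA IJ -JL ideal_mulCA.
Qed.

Lemma ideal_equivM I J L :
  ideal_equiv I J -> ideal_equiv (ideal_mul I L) (ideal_mul J L).
Proof.
by move=> [u [v [u0 v0 IJ]]]; exists u, v; split; rewrite // !ideal_mulA IJ.
Qed.

End IdealClasses.

(** * Chords and the group law *)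

Section Lines.

Variables (K : fieldType) (E : weierstrass K).
Implicit Types (f g : coord_ring E).

(* [vertical x] is the function X - x, [chord t m] the function Y - t X - m. *)
Definition vertical (x : K) : coord_ring E := coord_poly E ('X - x%:P).
Definition chord (t m : K) : coord_ring E := (- (t%:P * 'X + m%:P), 1).

(* At a singular point the three equations give a3, a4 and a6 in terms of a1,
   a2, x and y, and the discriminant then vanishes identically. *)
Lemma nonsingular x y : elliptic E -> on_curve E (Some (x, y)) ->
  (2 * y + wa1 E * x + wa3 E != 0) ||
  (3 * x ^+ 2 + 2 * wa2 E * x + wa4 E - wa1 E * y != 0).
Proof.
move=> + /eqP Exy; rewrite /elliptic; apply: contraR.
rewrite negb_or !negbK => /andP[/eqP dy /eqP dx]; apply/eqP.
have e3 : wa3 E = - (2 * y + wa1 E * x).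
  by apply/eqP; rewrite -addr_eq0 addrC dy.
have e4 : wa4 E = - (3 * x ^+ 2 + 2 * wa2 E * x - wa1 E * y).
  by apply/eqP; rewrite -addr_eq0 -[X in _ == X]dx; apply/eqP; ring.
have e6 : wa6 E = y ^+ 2 + wa1 E * x * y + wa3 E * y
                 - (x ^+ 3 + wa2 E * x ^+ 2 + wa4 E * x) by rewrite Exy; ring.
by rewrite /discriminant e6 e4 e3; ring.
Qed.

(** Substituting t X + m for Y in [f] leaves a polynomial that vanishes at [x], hence a multiple of
    X - x. So X - x and any non-vertical line through the point generate its ideal. *)
Lemma point_idealP x y t m f : y = t * x + m ->
  point_ideal (Some (x, y)) f -> exists q r, f = vertical x * q + chord t m * r.
Proof.
move=> -> /= f0; pose phi := f.1 + f.2 * (t%:P * 'X + m%:P).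
have : root phi x by rewrite /root /phi !hornerE -[X in _ == X]f0 /coord_eval
  mulrDr.
case/factor_theorem => q phiE; exists (coord_poly E q), (coord_poly E f.2).
apply: coord_eqP; rewrite coord_addE !coord_mulE /=; last by ring.
transitivity (phi - f.2 * (t%:P * 'X + m%:P)); first by rewrite /phi; ring.
by rewrite phiE; ring.
Qed.

Lemma vertical_point x y : point_ideal (Some (x, y)) (vertical x).
Proof. by rewrite /point_ideal /coord_eval /= !hornerE; ring. Qed.

Lemma chord_point t m x y : y = t * x + m ->
  point_ideal (Some (x, y)) (chord t m).
Proof. by move=> ->; rewrite /point_ideal /coord_eval /= !hornerE /=; ring. Qed.

(** The product lies in (X - x) because (Y - y)(Y - y') = (X - x) [r0]. Conversely, by
    nonsingularity one partial derivative at the point is a nonzero scalar, which makes X - x a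
    combination of products of generators. *)
Lemma point_ideal_opp x y : elliptic E -> on_curve E (Some (x, y)) ->
  ideal_mul (@point_ideal _ E (Some (x, y)))
    (point_ideal (ec_opp E (Some (x, y)))) = principal (vertical x).
Proof.
move=> ellE EP; have EnP := EP; rewrite -on_curve_opp in EnP.
set y' := - y - wa1 E * x - wa3 E.
(* The cofactor of X - x in the product of the horizontal lines through the two points. *)
pose r0 : coord_ring E := ('X ^+ 2 + (x + wa2 E)%:P * 'X
  + (x ^+ 2 + wa2 E * x + wa4 E)%:P, - (wa1 E)%:P).
have cubE : wa6 E = y ^+ 2 + wa1 E * x * y + wa3 E * y
               - (x ^+ 3 + wa2 E * x ^+ 2 + wa4 E * x).
  by move/eqP: EP => ->; ring.
have yyE : chord 0 y * chord 0 y' = vertical x * r0.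
  apply: coord_eqP; rewrite coord_mulE /= /wcub /wlin /y' ?cubE; ring.
apply/predeqP => h; split.
  move: h; apply: ideal_mul_sub => [|f g|f g].
  - by exists 0; rewrite mulr0.
  - by case: (principal_ideal (vertical x)) => _ + _; apply.
  case/(@point_idealP x y 0 y); first by rewrite mul0r add0r.
  move=> q [r ->].
  case/(@point_idealP x y' 0 y'); first by rewrite mul0r add0r.
  move=> q' [r' ->].
  exists (q * (vertical x * q' + chord 0 y' * r') + chord 0 y * r * q' + r0 * r
    * r').
  rewrite !mulrDl !mulrDr.
  by rewrite -[RHS]addr0 -[X in _ = _ + X](subrr (vertical x * r0 * r * r'))
    -{1}yyE; ring.
have IJ : is_ideal (ideal_mul (@point_ideal _ E (Some (x, y)))
                      (point_ideal (ec_opp E (Some (x, y))))).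
  exact/ideal_mul_ideal/point_ideal_ideal.
case: (IJ) => J0 JD JM [k ->]; apply: (JM); have xP := vertical_point.
have yP z z' : point_ideal (Some (z, z')) (chord 0 z').
  by apply: chord_point; rewrite mul0r add0r.
case/orP: (nonsingular ellE EP) => nz.
  (* The two horizontal lines differ by the scalar 2 y + a1 x + a3. *)
  pose c := coord_poly E (2 * y + wa1 E * x + wa3 E)^-1%:P.
  suff -> : vertical x = vertical x * chord 0 y' * c + chord 0 y * vertical x *
    (- c).
    by apply: JD; apply: (JM); apply: ideal_mulM; rewrite /ec_opp.
  have : coord_poly E (2 * y + wa1 E * x + wa3 E)%:P * c = 1.
    by rewrite -coord_polyM -polyCM divff.
  move: c => c cE; rewrite -{1}[vertical x]mulr1 -{1}cE.
  have -> : coord_poly E (2 * y + wa1 E * x + wa3 E)%:P = chord 0 y' - chord 0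
    y.
    by apply: coord_eqP; rewrite /= /y'; ring.
  ring.
(* Here [r0] is the nonzero scalar [w] modulo X - x and Y - y, while (X - x) [r0] is the product of
   the two lines. *)
pose w := 3 * x ^+ 2 + 2 * wa2 E * x + wa4 E - wa1 E * y.
pose c := coord_poly E w^-1%:P.
pose d := coord_poly E ('X + (2 * x + wa2 E)%:P).
suff -> : vertical x = chord 0 y * chord 0 y' * c + vertical x * vertical x *
  (- c * d)
    + chord 0 y * vertical x * (c * coord_poly E (wa1 E)%:P).
  by apply: (JD); [apply: JD|]; apply: JM; apply: ideal_mulM; rewrite /ec_opp.
have : coord_poly E w%:P * c = 1 by rewrite -coord_polyM -polyCM divff.
move: c => c cE; rewrite -{1}[vertical x]mulr1 -{1}cE yyE.
have -> : r0 = coord_poly E w%:P + vertical x * d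
               - chord 0 y * coord_poly E (wa1 E)%:P.
  by apply: coord_eqP; rewrite coord_addE ?coord_mulE /= /w; ring.
ring.
Qed.

Lemma same_abscissa x1 y1 x2 y2 :
    on_curve E (Some (x1, y1)) -> on_curve E (Some (x2, y2)) -> x1 = x2 ->
  Some (x1, y1) = Some (x2, y2) \/ Some (x1, y1) = ec_opp E (Some (x2, y2)).
Proof.
move=> /eqP E1 /eqP E2 x12; rewrite x12 in E1 *.
have /eqP : (y1 - y2) * (y1 + y2 + wa1 E * x2 + wa3 E) = 0.
  rewrite (_ : _ * _ = (y1 ^+ 2 + wa1 E * x2 * y1 + wa3 E * y1)
    - (y2 ^+ 2 + wa1 E * x2 * y2 + wa3 E * y2)); last by ring.
  by rewrite E1 E2 subrr.
rewrite mulf_eq0 subr_eq0 => /orP[/eqP ->|/eqP y0]; [by left | right].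
by rewrite -[y1]subr0 -y0 /=; congr (Some (_, _)); ring.
Qed.

(** The norm of a line is the equation of the curve restricted to it, a cubic with the two given
    abscissae as roots; its coefficient of X^2 determines the third root [x3]. *)
Lemma ec_add_chord x1 y1 x2 y2 :
    on_curve E (Some (x1, y1)) -> on_curve E (Some (x2, y2)) ->
    ~~ ((x1 == x2) && (y1 + y2 + wa1 E * x2 + wa3 E == 0)) ->
  exists t m x3,
    [/\ ec_add E (Some (x1, y1)) (Some (x2, y2)) =
          ec_opp E (Some (x3, t * x3 + m)),
        y1 = t * x1 + m, y2 = t * x2 + m
      & coord_norm (chord t m)
          = - (('X - x1%:P) * ('X - x2%:P) * ('X - x3%:P))].
Proof.
move=> E1 E2 nv; rewrite /ec_add (negPf nv).
set t := if _ then _ else _; pose m := y1 - t * x1.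
pose x3 := t ^+ 2 + wa1 E * t - wa2 E - x1 - x2; exists t, m, x3.
have y1E : y1 = t * x1 + m by rewrite /m; ring.
(* On the line y = t x + m the equation of the curve differs from
   - (x - x1) (x - x2) (x - x3) by d1 x + d0. *)
pose d1 := 2 * t * m + wa1 E * m + wa3 E * t - wa4 E
           + (x1 * x2 + x1 * x3 + x2 * x3).
pose d0 := m ^+ 2 + wa3 E * m - wa6 E - x1 * x2 * x3.
have curveE x : (t * x + m) ^+ 2 + wa1 E * x * (t * x + m)
    + wa3 E * (t * x + m) - (x ^+ 3 + wa2 E * x ^+ 2 + wa4 E * x + wa6 E)
  = - (x - x1) * (x - x2) * (x - x3) + d1 * x + d0.
  by rewrite /d1 /d0 /x3; ring.
have D1 : d1 * x1 + d0 = 0.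
  have := curveE x1; rewrite -y1E; move/eqP: E1 => ->; rewrite subrr => /esym.
  by rewrite subrr oppr0 !mul0r add0r.
(* For distinct abscissae the remainder d1 x + d0 has two roots. Otherwise the points coincide, and
   the slope of the tangent is what makes [d1] vanish. *)
have [y2E d1E] : y2 = t * x2 + m /\ d1 = 0.
  case: (eqVneq x1 x2) => [x12|x12]; last first.
    have y2E : y2 = t * x2 + m.
      rewrite /m /t (negPf x12); field.
      by rewrite subr_eq0 eq_sym.
    have D2 : d1 * x2 + d0 = 0.
      have := curveE x2; rewrite -y2E; move/eqP: E2 => ->; rewrite subrr.
      by move/esym; rewrite subrr mulr0 mul0r add0r.
    split=> //; apply/eqP; have : d1 * (x1 - x2) == 0.
      by rewrite mulrBr subr_eq0 -(inj_eq (addIr d0)) D1 D2.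
    by rewrite mulf_eq0 (subr_eq0 x1) (negPf x12) orbF.
  have y12 : y1 = y2.
    case: (same_abscissa E1 E2 x12) => [[_ //]|[_ y1E']].
    by case/negP: nv; rewrite x12 eqxx y1E'; apply/eqP; ring.
  have s0 : 2 * y1 + wa1 E * x1 + wa3 E != 0.
    move: nv; rewrite -x12 -y12 eqxx /=; congr (_ != _); ring.
  split; first by rewrite -y12 -x12.
  have tE : t * (2 * y1 + wa1 E * x1 + wa3 E)
            = 3 * x1 ^+ 2 + 2 * wa2 E * x1 + wa4 E - wa1 E * y1.
    by rewrite /t x12 eqxx -x12 divfK.
  transitivity (t * (2 * y1 + wa1 E * x1 + wa3 E)
       - (3 * x1 ^+ 2 + 2 * wa2 E * x1 + wa4 E - wa1 E * y1)).
    by rewrite /d1 /x3 /m -x12; ring.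
  by rewrite tE subrr.
have d0E : d0 = 0 by rewrite -D1 d1E mul0r add0r.
split=> //.
  by rewrite /ec_opp; congr (Some (_, _)); rewrite /m /x3; ring.
have e4 : wa4 E = 2 * t * m + wa1 E * m + wa3 E * t
           + (x1 * x2 + x1 * x3 + x2 * x3).
  by apply/eqP; rewrite -subr_eq0 -oppr_eq0 -d1E /d1; apply/eqP; ring.
have e6 : wa6 E = m ^+ 2 + wa3 E * m - x1 * x2 * x3.
  by apply/eqP; rewrite -subr_eq0 -oppr_eq0 -d0E /d0; apply/eqP; ring.
have e2 : wa2 E = t ^+ 2 + wa1 E * t - x3 - x1 - x2 by rewrite /x3; ring.
by rewrite /coord_norm /= /wcub /wlin e6 e4 e2; ring.
Qed.

End Lines.

(** * The group law from ideal classes *)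

Section GroupLaw.

Variables (K : fieldType) (E : weierstrass K).
Hypothesis ellE : elliptic E.
Implicit Types (f g : coord_ring E) (P Q S T : option (K * K)).
Let pid := @point_ideal K E.

Lemma chord_coord_poly t m x1 x2 x3 :
    coord_norm (chord E t m) = - (('X - x1%:P) * ('X - x2%:P) * ('X - x3%:P)) ->
  chord E t m * coord_conj (chord E t m) =
    - (vertical E x1 * vertical E x2 * vertical E x3) :> coord_ring E.
Proof.
move=> Nl; rewrite coord_mul_conj Nl -!coord_polyM.
by rewrite /coord_poly coord_oppE /= oppr0.
Qed.

Lemma chord_on_curve t m x :
  (coord_norm (chord E t m)).[x] = 0 -> on_curve E (Some (x, t * x + m)).
Proof.
rewrite /coord_norm /= /wcub /wlin !hornerE /= => N0.
by rewrite /on_curve -subr_eq0 -[X in _ == X]N0; apply/eqP; ring.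
Qed.

Lemma chord_conj t m : coord_conj (chord E t m) =
  - chord E (- (t + wa1 E)) (- (m + wa3 E)) :> coord_ring E.
Proof. by apply: coord_eqP; rewrite coord_oppE /= /wlin; ring. Qed.

(** Expanded in the generators X - xi and l of the three ideals, every term contains l except the
    multiple of v1 v2 v3, which is - l times its conjugate. *)
Lemma chord_ideal_sub t m x1 x2 x3 f :
    coord_norm (chord E t m) = - (('X - x1%:P) * ('X - x2%:P) * ('X - x3%:P)) ->
    ideal_mul (pid (Some (x1, t * x1 + m))) (ideal_mul
      (pid (Some (x2, t * x2 + m))) (pid (Some (x3, t * x3 + m)))) f ->
  principal (chord E t m) f.
Proof.
move=> /chord_coord_poly; set l := chord E t m; set l' := coord_conj l => Nl.
have [p0 pD pM] := principal_ideal (l : coord_ring E).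
move: f; apply: ideal_mul_sub =>
  // f1 f23 /(point_idealP (erefl _)) [q1 [r1 ->]].
move: f23; apply: ideal_mul_sub => [|f g|f2 f3].
- by rewrite mulr0.
- by rewrite mulrDr; apply: pD.
move=> /(point_idealP (erefl _)) [q2 [r2 ->]].
move=> /(point_idealP (erefl _)) [q3 [r3 ->]]; rewrite -/l.
move: (vertical E x1) (vertical E x2) (vertical E x3) Nl => v1 v2 v3 Nl.
exists (- l' * q1 * q2 * q3 + r1 * (v2 * q2 + l * r2) * (v3 * q3 + l * r3)
   + v1 * q1 * r2 * (v3 * q3 + l * r3) + v1 * q1 * v2 * q2 * r3).
transitivity (v1 * v2 * v3 * (q1 * q2 * q3)
   + l * (r1 * (v2 * q2 + l * r2) * (v3 * q3 + l * r3)
   + v1 * q1 * r2 * (v3 * q3 + l * r3) + v1 * q1 * v2 * q2 * r3));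
     first by ring.
have -> : v1 * v2 * v3 = - (l * l') by rewrite Nl opprK.
by ring.
Qed.

(* The product J of the three ideals lies in (l), the product J' of the ideals
   of the opposite points in (l'), where l' is conjugate to l up to sign, and
   J J' = (l l'), so J = (l). *)
Lemma chord_ideal t m x1 x2 x3 :
    coord_norm (chord E t m) = - (('X - x1%:P) * ('X - x2%:P) * ('X - x3%:P)) ->
    ideal_mul (pid (Some (x1, t * x1 + m))) (ideal_mul
      (pid (Some (x2, t * x2 + m))) (pid (Some (x3, t * x3 + m)))) =
  principal (chord E t m).
Proof.
move=> Nl; have Nl' := chord_coord_poly Nl.
have onE x : x \in [:: x1; x2; x3] -> on_curve E (Some (x, t * x + m)).
  move=> xin; apply: chord_on_curve; rewrite Nl !hornerE /=; apply/eqP.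
  rewrite oppr_eq0 !mulf_eq0 !subr_eq0; move: xin; rewrite !inE.
  by case/or3P => ->; rewrite ?orbT.
set J := ideal_mul _ _.
have Jid : is_ideal J by do 2!apply: ideal_mul_ideal;
  apply: point_ideal_ideal; apply: onE; rewrite !inE eqxx ?orbT.
apply/predeqP => f; split; first exact: chord_ideal_sub.
case=> k ->; case: (Jid) => _ _; apply => {k f}.
(* The line through the opposite points; it has the same norm. *)
pose t' := - (t + wa1 E); pose m' := - (m + wa3 E).
have oppE x : ec_opp E (Some (x, t * x + m)) = Some (x, t' * x + m').
  by rewrite /ec_opp /t' /m'; congr (Some (_, _)); ring.
have Nc : coord_norm (chord E t' m')
     = - (('X - x1%:P) * ('X - x2%:P) * ('X - x3%:P)).
  by rewrite -Nl /coord_norm /= /t' /m' /wlin; ring.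
pose J' := ideal_mul (pid (Some (x1, t' * x1 + m'))) (ideal_mul
      (pid (Some (x2, t' * x2 + m'))) (pid (Some (x3, t' * x3 + m')))).
have JJ' : ideal_mul J J' (chord E t m * chord E t' m').
  rewrite /J /J' ideal_mulACA [ideal_mul (ideal_mul (pid (Some (x2, _))) _)
    _]ideal_mulACA -!oppE.
  rewrite /pid !point_ideal_opp ?onE ?inE ?eqxx ?orbT // !principal_mul.
  exists 1; rewrite mulr1 mulrA -[RHS]opprK -Nl' chord_conj; ring.
(* Every element of J J' is l' times an element of J; for l l', cancelling l' puts l in J. *)
suff [g Jg] : exists2 g, J g & chord E t m * chord E t' m' = chord E t' m' * g.
  rewrite mulrC => /coord_mulfI -> //.
  by apply/eqP => -[_ /eqP]; rewrite oner_eq0.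
move: (chord E t m * _) JJ'; apply: ideal_mul_sub.
- by exists 0; rewrite ?mulr0 //; case: Jid.
- move=> _ _ [f Jf ->] [g Jg ->]; exists (f + g); last by rewrite mulrDr.
  by case: Jid => _ + _; apply.
- move=> f _ Jf /(chord_ideal_sub Nc)[g ->]; exists (f * g); last by ring.
  by case: Jid => _ _; apply.
Qed.

Lemma on_curve_add P Q : on_curve E P -> on_curve E Q ->
  on_curve E (ec_add E P Q).
Proof.
case: P Q => [[x1 y1]|] [[x2 y2]|] // E1 E2.
case: (boolP ((x1 == x2) && (y1 + y2 + wa1 E * x2 + wa3 E == 0))) => v.
  by rewrite /= v.
have [t [m [x3 [-> _ _ Nl]]]] := ec_add_chord E1 E2 v.
rewrite on_curve_opp; apply: chord_on_curve.
by rewrite Nl !hornerE /= subrr mulr0 oppr0.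
Qed.

Lemma ec_addNP P : ec_add E (ec_opp E P) P = None.
Proof. by case: P => [[x y]|] //=; rewrite eqxx ifT //; apply/eqP; ring. Qed.

(** Read off the formula directly, since associativity and commutativity are deduced from it. *)
Lemma ec_add_eqN P Q : ec_add E P (ec_opp E Q) = None -> P = Q.
Proof.
case: P Q => [[x1 y1]|] [[x2 y2]|] //=; case: ifP => // /andP[/eqP -> +] _.
rewrite -[X in X == 0](_ : y1 - y2 = _); last by ring.
by rewrite subr_eq0 => /eqP ->.
Qed.

(** Let R be the third intersection of the chord l, so that P + Q = -R. Then I_P I_Q I_R = (l) and
    I_R I_(-R) = (X - x3), so (X - x3) I_P I_Q = (l) I_(-R). *)
Lemma point_ideal_add P Q : on_curve E P -> on_curve E Q ->
  ideal_equiv (ideal_mul (pid P) (pid Q)) (pid (ec_add E P Q)).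
Proof.
case: P Q => [[x1 y1]|] [[x2 y2]|] E1 E2; last first.
- by rewrite /pid [ec_add _ _ _]/= point_ideal0 principal_mul mulr1;
  apply: ideal_equiv_refl.
- rewrite /pid [ec_add _ _ _]/= point_ideal0 principal1_mul;
  last exact: point_ideal_ideal.
  exact: ideal_equiv_refl.
- rewrite /pid [ec_add _ _ _]/= point_ideal0 ideal_mulC principal1_mul.
    exact: ideal_equiv_refl.
  exact: point_ideal_ideal.
case: (boolP ((x1 == x2) && (y1 + y2 + wa1 E * x2 + wa3 E == 0))) => v.
  have -> : ec_add E (Some (x1, y1)) (Some (x2, y2)) = None by rewrite /= v.
  case/andP: v => /eqP x12 /eqP y12.
  have -> : Some (x2, y2) = ec_opp E (Some (x1, y1)).
    by rewrite /= x12 -[y2]subr0 -y12; congr (Some (_, _)); ring.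
  rewrite point_ideal_opp // /pid point_ideal0; exists 1, (vertical E x1).
  by rewrite !principal_mul mulr1 mul1r oner_neq0 coord_poly_neq0
    ?polyXsubC_eq0.
have [t [m [x3 [-> -> -> Nl]]]] := ec_add_chord E1 E2 v.
have E3 : on_curve E (Some (x3, t * x3 + m)).
  by apply: chord_on_curve; rewrite Nl !hornerE /= subrr mulr0 oppr0.
exists (vertical E x3), (chord E t m); split.
- by rewrite coord_poly_neq0 ?polyXsubC_eq0.
- by apply/eqP => -[_ /eqP]; rewrite oner_eq0.
by rewrite -(point_ideal_opp ellE E3) -(chord_ideal Nl) [LHS]ideal_mulC
  !ideal_mulA.
Qed.

(** A degree is either even or of the form 2 deg b + 3, hence never 1. *)
Lemma size_coord_norm_neq2 f : size (coord_norm f) != 2.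
Proof.
rewrite size_coord_norm; case: f => [a b] /=; case: (eqVneq b 0) => [_|b0].
  by rewrite maxn0; case: (size a) => // k; rewrite doubleS -!pred_Sn; lia.
have : (0 < size b)%N by rewrite size_poly_gt0.
by move: (size a) (size b) => m k; lia.
Qed.

Lemma size_coord_norm_eq1 f : size (coord_norm f) = 1 ->
  exists2 c, c != 0 & f = coord_poly E c%:P.
Proof.
rewrite size_coord_norm; case: f => [a b] /=; case: (eqVneq b 0) => [->|b0].
  rewrite maxn0 => sa; have /eqP/size_poly1P[c c0 ->] : size a = 1.
    by move: sa; case: (size a) => // k; rewrite doubleS -!pred_Sn; lia.
  by exists c.
have : (0 < size b)%N by rewrite size_poly_gt0.
by move: (size a) (size b) => m k; lia.
Qed.

(* A generator w of the ideal of an affine point divides X - x, but its norm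
   cannot have degree 1. *)
Lemma point_ideal_principal P : on_curve E P ->
  ideal_equiv (pid P) (principal 1) -> P = None.
Proof.
case: P => [[x y]|] // EP [u [v [u0 v0]]];
  rewrite principal_mul mulr1 => /predeqP.
have Pid := point_ideal_ideal EP.
move=> uI; have [w Pw vE] : exists2 w, pid (Some (x, y)) w & v = u * w.
  by apply/principal_mulP => //; apply/uI; exists 1; rewrite mulr1.
have wP f : pid (Some (x, y)) f -> exists h, f = w * h.
  move=> Pf; have /uI[h] : ideal_mul (principal u) (pid (Some (x, y))) (u * f).
    by apply/principal_mulP => //; exists f.
  by rewrite vE -mulrA => /(coord_mulfI u0) ->; exists h.
have [g wg] := wP _ (@vertical_point _ E x y).
have [h wh] : exists h, chord E 0 y = w * h.
  by apply/wP/chord_point; rewrite mul0r add0r.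
have : size (coord_norm w * coord_norm g) = 3.
  rewrite -coord_normM -wg /coord_norm /= expr0n /= mulr0 !mul0r !subr0.
  by rewrite size_exp_XsubC.
have w0 : w != 0.
  by apply: contraNneq v0 => w0; rewrite vE w0 mulr0.
have g0 : g != 0.
  apply/eqP => g0; move/eqP: wg; rewrite g0 mulr0; apply/negP.
  by rewrite coord_poly_neq0 ?polyXsubC_eq0.
rewrite size_mul ?coord_norm_eq0 //.
have := size_coord_norm_neq2 w; have := size_coord_norm_neq2 g.
have : (0 < size (coord_norm w))%N by rewrite size_poly_gt0 coord_norm_eq0.
have : (0 < size (coord_norm g))%N by rewrite size_poly_gt0 coord_norm_eq0.
move=> sg sw sg2 sw2 sgw.
(* The norm of X - x has degree 2, so one factor is a nonzero constant. If it is [w], it vanishes at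
   the point; if it is [g], then X - x divides a nonzero multiple of Y - y. Both are absurd. *)
have [] : size (coord_norm w) = 1 \/ size (coord_norm g) = 1.
  by move: (size (coord_norm w)) (size (coord_norm g)) sg sw sg2 sw2 sgw; lia.
  case/size_coord_norm_eq1 => c c0 wE; case/eqP: c0.
  by move: Pw; rewrite wE /pid /= /coord_eval /= !hornerE /= => <-; ring.
case/size_coord_norm_eq1 => c c0 gE; case/eqP: c0.
have : coord_poly E c%:P * chord E 0 y = vertical E x * h.
  by rewrite wh wg gE; ring.
case/(congr1 (fun f : coord_ring E => f.2.[x])).
by rewrite !coord_mulE /= !hornerE /= subrr mul0r !subr0 => ->.
Qed.

(** Both sides have the class of I_P I_Q I_S, so their difference has trivial class and is the point
    at infinity. *)
Lemma ec_addA P Q S : on_curve E P -> on_curve E Q -> on_curve E S ->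
  ec_add E P (ec_add E Q S) = ec_add E (ec_add E P Q) S.
Proof.
move=> EP EQ ES; set T := ec_add E P _; set T' := ec_add E _ S.
have ET : on_curve E T by rewrite !on_curve_add.
have ET' : on_curve E T' by rewrite !on_curve_add.
have TT' : ideal_equiv (pid T) (pid T').
  apply: (@ideal_equiv_trans _ _ (ideal_mul (pid P) (ideal_mul (pid Q) (pid
    S)))).
    apply: ideal_equiv_sym; rewrite ideal_mulC.
    apply: (@ideal_equiv_trans _ _ (ideal_mul (pid (ec_add E Q S)) (pid P))).
      exact/ideal_equivM/point_ideal_add.
    by rewrite ideal_mulC; apply: point_ideal_add; rewrite ?on_curve_add.
  rewrite ideal_mulA.
  apply: (@ideal_equiv_trans _ _ (ideal_mul (pid (ec_add E P Q)) (pid S))).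
    exact/ideal_equivM/point_ideal_add.
  by apply: point_ideal_add; rewrite ?on_curve_add.
apply: ec_add_eqN; apply: point_ideal_principal.
  by rewrite on_curve_add ?on_curve_opp.
apply: (@ideal_equiv_trans _ _ (ideal_mul (pid T) (pid (ec_opp E T')))).
  by apply: ideal_equiv_sym; apply: point_ideal_add; rewrite ?on_curve_opp.
apply: (@ideal_equiv_trans _ _ (ideal_mul (pid T') (pid (ec_opp E T')))).
  exact: ideal_equivM.
apply: (ideal_equiv_trans (point_ideal_add ET' _));
  first by rewrite on_curve_opp.
have -> : ec_add E T' (ec_opp E T') = None by rewrite -{1}[T'](ec_oppK E)
  ec_addNP.
by rewrite /pid point_ideal0; apply: ideal_equiv_refl.
Qed.

Lemma ec_addC P Q : on_curve E P -> on_curve E Q -> ec_add E P Q = ec_add E Q P.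
Proof.
move=> EP EQ; apply: ec_add_eqN; apply: point_ideal_principal.
  by rewrite !on_curve_add ?on_curve_opp ?on_curve_add.
set T' := ec_add E Q P.
have ET' : on_curve E T' by rewrite on_curve_add.
have ET : on_curve E (ec_add E P Q) by rewrite on_curve_add.
apply: (@ideal_equiv_trans _ _ (ideal_mul (pid (ec_add E P Q)) (pid (ec_opp E
  T')))).
  by apply: ideal_equiv_sym; apply: point_ideal_add; rewrite ?on_curve_opp.
apply: (@ideal_equiv_trans _ _ (ideal_mul (pid T') (pid (ec_opp E T')))).
  apply: ideal_equivM; apply: (@ideal_equiv_trans _ _ (ideal_mul (pid P) (pid
    Q))).
    exact/ideal_equiv_sym/point_ideal_add.
  by rewrite ideal_mulC; apply: point_ideal_add.
apply: (ideal_equiv_trans (point_ideal_add ET' _));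
  first by rewrite on_curve_opp.
have -> : ec_add E T' (ec_opp E T') = None by rewrite -{1}[T'](ec_oppK E)
  ec_addNP.
by rewrite /pid point_ideal0; apply: ideal_equiv_refl.
Qed.

End GroupLaw.

(** * The group of points and its torsion *)

(** The type mentions [ellE] because the group structure attached to it depends on this proof. *)
Definition ec_point (K : fieldType) (E : weierstrass K) (ellE : elliptic E) :
  Type := {P : option (K * K) | on_curve E P}.

HB.instance Definition _ (K : fieldType) (E : weierstrass K)
  (ellE : elliptic E) :=
  SubChoice.copy (ec_point ellE) {P : option (K * K) | on_curve E P}.

Section PointGroup.

Variables (K : fieldType) (E : weierstrass K) (ellE : elliptic E).
Implicit Types (P Q S : ec_point ellE).

Definition mk_point (P : option (K * K)) (EP : on_curve E P) : ec_point ellE :=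
  exist _ P EP.

Definition point_add P Q := mk_point (on_curve_add (valP P) (valP Q)).
Definition point_zero := @mk_point None isT.
Fact point_opp_subproof P : on_curve E (ec_opp E (val P)).
Proof. by rewrite on_curve_opp (valP P). Qed.
Definition point_opp P := mk_point (point_opp_subproof P).

Fact point_addA : associative point_add.
Proof. by move=> P Q S; apply/val_inj/(ec_addA ellE); apply: valP. Qed.
Fact point_addC : commutative point_add.
Proof. by move=> P Q; apply/val_inj/(ec_addC ellE); apply: valP. Qed.
Fact point_add0 : left_id point_zero point_add.
Proof. by move=> P; apply: val_inj. Qed.
Fact point_addN : left_inverse point_zero point_opp point_add.
Proof. by move=> P; apply/val_inj/ec_addNP. Qed.

HB.instance Definition _ := GRing.isZmodule.Build (ec_point ellE)
  point_addA point_addC point_add0 point_addN.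

Lemma val_pointD P Q : val (P + Q) = ec_add E (val P) (val Q).
Proof. by []. Qed.

Lemma val_pointN P : val (- P) = ec_opp E (val P).
Proof. by []. Qed.

Lemma val_point_mul P k : val (P *+ k) = ec_mul E k (val P).
Proof. by elim: k => // k IH; rewrite mulrS val_pointD IH. Qed.

Lemma val_point_eq0 P : (val P = None) <-> (P = 0).
Proof. by split=> [P0|-> //]; apply: val_inj. Qed.

End PointGroup.

(** * Abscissae of multiples of a point *)

Section XCoordinates.

Variables (K : fieldType) (E : weierstrass K).

Definition wb2 := wa1 E ^+ 2 + 4 * wa2 E.
Definition wb4 := 2 * wa4 E + wa1 E * wa3 E.
Definition wb6 := wa3 E ^+ 2 + 4 * wa6 E.
Definition wb8 := wa1 E ^+ 2 * wa6 E + 4 * wa2 E * wa6 E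
  - wa1 E * wa3 E * wa4 E + wa2 E * wa3 E ^+ 2 - wa4 E ^+ 2.

Lemma wa6_on_curve x y : on_curve E (Some (x, y)) ->
  wa6 E = y ^+ 2 + wa1 E * x * y + wa3 E * y
          - (x ^+ 3 + wa2 E * x ^+ 2 + wa4 E * x).
Proof. by move/eqP => ->; ring. Qed.

Lemma two_torsion_x x y : on_curve E (Some (x, y)) ->
  (2 * y + wa1 E * x + wa3 E) ^+ 2 =
  4 * x ^+ 3 + wb2 * x ^+ 2 + 2 * wb4 * x + wb6.
Proof. by move/wa6_on_curve => e; rewrite /wb2 /wb4 /wb6 e; ring. Qed.

Lemma ec_double_x x y : on_curve E (Some (x, y)) ->
    ec_add E (Some (x, y)) (Some (x, y)) != None ->
  let d := 4 * x ^+ 3 + wb2 * x ^+ 2 + 2 * wb4 * x + wb6 in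
  d != 0 /\ exists y', ec_add E (Some (x, y)) (Some (x, y)) =
    Some ((x ^+ 4 - wb4 * x ^+ 2 - 2 * wb6 * x - wb8) / d, y').
Proof.
move=> Exy; rewrite /= eqxx /=.
rewrite (_ : y + y + _ + _ = 2 * y + wa1 E * x + wa3 E); last by ring.
case: ifP => // /negbT s0 _; rewrite -(two_torsion_x Exy) expf_neq0 //;
  split=> //.
eexists; congr (Some (_, _));
  apply: (@mulIf _ ((2 * y + wa1 E * x + wa3 E) ^+ 2)).
  by rewrite expf_neq0.
rewrite divfK ?expf_neq0 // /wb4 /wb6 /wb8 (wa6_on_curve Exy).
by move: (s0); set s := (2 * y + _ + _) => ?; rewrite /s; field.
Qed.

(** The sum of the abscissae is unchanged when either point is replaced by its opposite, so the
    ordinates enter only through y^2 + a1 x y + a3 y, which the equation of the curve eliminates. *)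
Lemma ec_add_sub_x x1 y1 x2 y2 : on_curve E (Some (x1, y1)) ->
    on_curve E (Some (x2, y2)) -> x1 != x2 ->
  exists x3 y3 x4 y4,
    [/\ ec_add E (Some (x1, y1)) (Some (x2, y2)) = Some (x3, y3),
        ec_add E (Some (x1, y1)) (ec_opp E (Some (x2, y2))) = Some (x4, y4)
      & x3 + x4 = (2 * x1 * x2 * (x1 + x2) + wb2 * (x1 * x2)
           + wb4 * (x1 + x2) + wb6) / (x1 - x2) ^+ 2].
Proof.
move=> E1 E2 x12; rewrite /= (negPf x12) /=; do 4!eexists; split=> //.
have d0 : x1 - x2 != 0 by rewrite subr_eq0.
have d0' : x2 - x1 != 0 by rewrite subr_eq0 eq_sym.
apply: (@mulIf _ ((x1 - x2) ^+ 2)); first by rewrite expf_neq0.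
rewrite divfK ?expf_neq0 // /wb2 /wb4 /wb6.
transitivity (2 * (y1 ^+ 2 + wa1 E * x1 * y1 + wa3 E * y1)
  + 2 * (y2 ^+ 2 + wa1 E * x2 * y2 + wa3 E * y2)
  + (wa1 E * x1 + wa3 E) * (wa1 E * x2 + wa3 E)
  - 2 * (wa2 E + x1 + x2) * (x1 - x2) ^+ 2); first by field.
by move/eqP: E1 => ->; move/eqP: E2 => ->; ring.
Qed.

End XCoordinates.

Section TopCoefficient.

Variable R : comNzRingType.
Implicit Types (p q : {poly R}) (a b : R).

Definition top_coef n a p := (size p <= n.+1)%N /\ p`_n = a.

Lemma top_coefD n a b p q :
  top_coef n a p -> top_coef n b q -> top_coef n (a + b) (p + q).
Proof.
move=> [sp <-] [sq <-]; split; rewrite ?coefD //.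
by rewrite (leq_trans (size_polyD _ _)) // geq_max sp.
Qed.

Lemma top_coefM m n a b p q :
  top_coef m a p -> top_coef n b q -> top_coef (m + n) (a * b) (p * q).
Proof.
move=> [sp <-] [sq <-]; split.
  apply: leq_trans (size_polyMleq _ _) _.
  by rewrite -subn1 leq_subLR (leq_trans (leq_add sp sq)) // addSn addnS.
rewrite coefM (bigD1 (inord m)) //= inordK ?ltnS ?leq_addr // addKn big1 ?addr0
  //.
move=> i /eqP im; case: (ltngtP m i) => mi.
- by rewrite nth_default ?mul0r // (leq_trans sp).
- rewrite [X in _ * X]nth_default ?mulr0 // (leq_trans sq) //.
  by have := ltn_ord i; move: mi; clear; lia.
- by case: im; apply: val_inj; rewrite /= inordK ?ltnS ?leq_addr.
Qed.

Lemma top_coefB n a b p q :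
  top_coef n a p -> top_coef n b q -> top_coef n (a - b) (p - q).
Proof.
move=> hp [sq <-]; apply: top_coefD => //.
by split; rewrite ?size_polyN ?coefN.
Qed.

Lemma top_coefC a : top_coef 0 a a%:P.
Proof. by split; rewrite ?size_polyC_leq1 ?coefC. Qed.

Lemma top_coefX : top_coef 1 1 ('X : {poly R}).
Proof. by split; rewrite ?size_polyX ?coefX. Qed.

Lemma top_coefXn k n a p : top_coef n a p -> top_coef (k * n) (a ^+ k) (p ^+ k).
Proof.
move=> hp; elim: k => [|k IH]; first by rewrite !expr0; apply: top_coefC.
by rewrite !exprS mulSn; apply: top_coefM.
Qed.

Lemma top_coefZ n a b p : top_coef n a p -> top_coef n (b * a) (b%:P * p).
Proof. by move=> h; rewrite -[n]add0n; apply: top_coefM => //;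
  apply: top_coefC. Qed.

Lemma top_coefW m n a p : (m < n)%N -> top_coef m a p -> top_coef n 0 p.
Proof.
move=> mn [sp _]; split; first by rewrite (leq_trans sp) // ltnW.
by rewrite nth_default // (leq_trans sp).
Qed.

Lemma top_coef_eq m n a b p : top_coef m a p -> m = n -> a = b ->
  top_coef n b p.
Proof. by move=> ? <- <-. Qed.

End TopCoefficient.

Lemma mulrn_coprimeK (M : zmodType) (q a : nat) (x : M) : coprime q a ->
  x *+ q = 0 -> exists k, x *+ a *+ k = x.
Proof.
case: a => [|a] cqa xq.
  exists 0; move: cqa xq; rewrite /coprime gcdn0 => /eqP ->.
  by rewrite mulr1n mulr0n.
have [k l kl _] := egcdnP q (ltn0Sn a).
exists k; rewrite -mulrnA mulnC kl gcdnC (eqP cqa) mulrnDr mulr1n mulnC mulrnA.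
by rewrite xq mul0rn add0r.
Qed.

Section MultiplicationPolynomials.

Variables (K : fieldType) (E : weierstrass K) (ellE : elliptic E).
Implicit Types (P Q : ec_point ellE) (X Z : {poly K}).

Let b2 := (wb2 E)%:P.
Let b4 := (wb4 E)%:P.
Let b6 := (wb6 E)%:P.
Let b8 := (wb8 E)%:P.

(* X / Z computes the abscissa of m P; e stands for m ^ 2 - 1. *)
Definition mult_polys m e X Z :=
  [/\ (m ^ 2 = e.+1)%N, top_coef e.+1 1 X, top_coef e (m ^ 2)%:R Z &
    forall P x y, val P = Some (x, y) ->
      (forall j, (0 < j <= m)%N -> P *+ j != 0) ->
    Z.[x] != 0 /\ exists y', val (P *+ m) = Some (X.[x] / Z.[x], y')].

(** The duplication formula at X / Z, with numerator and denominator multiplied by Z^4; only X^4 and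
    4 X^3 Z reach the top degrees. *)
Lemma mult_polys_double k e X Z : mult_polys k e X Z ->
  mult_polys k.*2 (4 * e + 3)
   (X ^+ 4 - b4 * (X ^+ 2 * Z ^+ 2) - b6 * (2%:P * (X * Z ^+ 3)) - b8 * Z ^+ 4)
   (Z * (4%:P * X ^+ 3 + b2 * (X ^+ 2 * Z) + b4 * (2%:P * (X * Z ^+ 2))
        + b6 * Z ^+ 3)).
Proof.
case=> ke hX hZ hP; set X' := (X in mult_polys _ _ X _).
set Z' := (Z in mult_polys _ _ _ Z).
have ke2 : (k.*2 ^ 2 = (4 * e + 3).+1)%N by rewrite -mul2n expnMn ke; lia.
have lt n m a p : (n < m)%N -> top_coef n a p ->
  top_coef m 0 p by apply: top_coefW.
split=> //.
- have h1 := top_coefXn 4 hX.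
  have h2 : top_coef (4 * e.+1) 0 (b4 * (X ^+ 2 * Z ^+ 2)).
    apply: lt (top_coefZ _ (top_coefM (top_coefXn 2 hX) (top_coefXn 2 hZ)));
      lia.
  have h3 : top_coef (4 * e.+1) 0 (b6 * (2%:P * (X * Z ^+ 3))).
    by apply: lt (top_coefZ _ (top_coefZ _ (top_coefM hX (top_coefXn 3 hZ))));
      lia.
  have h4 : top_coef (4 * e.+1) 0 (b8 * Z ^+ 4).
    by apply: lt (top_coefZ _ (top_coefXn 4 hZ)); lia.
  apply: top_coef_eq (top_coefB (top_coefB (top_coefB h1 h2) h3) h4) _ _.
    by lia.
  by rewrite !subr0 expr1n.
- have h1 := top_coefZ 4 (top_coefXn 3 hX).
  have h2 : top_coef (3 * e.+1) 0 (b2 * (X ^+ 2 * Z)).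
    by apply: lt (top_coefZ _ (top_coefM (top_coefXn 2 hX) hZ)); lia.
  have h3 : top_coef (3 * e.+1) 0 (b4 * (2%:P * (X * Z ^+ 2))).
    by apply: lt (top_coefZ _ (top_coefZ _ (top_coefM hX (top_coefXn 2 hZ))));
      lia.
  have h4 : top_coef (3 * e.+1) 0 (b6 * Z ^+ 3).
    by apply: lt (top_coefZ _ (top_coefXn 3 hZ)); lia.
  apply: top_coef_eq (top_coefM hZ (top_coefD (top_coefD (top_coefD h1 h2) h3)
    h4)) _ _.
    by lia.
  by rewrite -mul2n expnMn natrM; ring.
move=> P x y Pxy nP; have [|Z0 [y' kP]] := hP P x y Pxy.
  by move=> j j_le; apply: nP; move: j_le; lia.
have k0 : (0 < k)%N by case: (k) ke.
have EkP := valP (P *+ k); rewrite kP in EkP.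
have dblP : val (P *+ k.*2) =
    ec_add E (Some (X.[x] / Z.[x], y')) (Some (X.[x] / Z.[x], y')).
  by rewrite -addnn mulrnDr val_pointD kP.
have dblP0 : val (P *+ k.*2) != None.
  by apply/eqP => /val_point_eq0/eqP; apply/negP/nP;
    rewrite double_gt0 k0 leqnn.
rewrite dblP in dblP0 *; have [d0 [y'' ->]] := ec_double_x EkP dblP0.
set d := (4 * _ + _ + _ + _) in d0 *.
have Z'x : Z'.[x] = Z.[x] ^+ 4 * d.
  by rewrite /Z' /d /b2 /b4 /b6 /wb2 /wb4 /wb6 !hornerE /=; field.
have X'x : X'.[x] = Z.[x] ^+ 4 * ((X.[x] / Z.[x]) ^+ 4
    - wb4 E * (X.[x] / Z.[x]) ^+ 2 - 2 * wb6 E * (X.[x] / Z.[x]) - wb8 E).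
  by rewrite /X' /b4 /b6 /b8 /wb4 /wb6 /wb8 !hornerE /=; field.
split; first by rewrite Z'x mulf_neq0 ?expf_neq0.
by exists y''; rewrite X'x Z'x -mulf_div divff ?mul1r ?expf_neq0.
Qed.

(* (2 k + 1) P and P are the sum and the difference of (k + 1) P and k P. *)
Lemma mult_polys_odd k e1 e2 X1 Z1 X2 Z2 :
    mult_polys k e1 X1 Z1 -> mult_polys k.+1 e2 X2 Z2 ->
  let D := X1 * Z2 - X2 * Z1 in
  mult_polys k.*2.+1 (2 * (e1 + e2 + 1))
   (2%:P * (X1 * X2 * (X1 * Z2 + X2 * Z1)) + b2 * (X1 * X2 * Z1 * Z2)
    + b4 * ((X1 * Z2 + X2 * Z1) * Z1 * Z2) + b6 * (Z1 ^+ 2 * Z2 ^+ 2)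
    - 'X * D ^+ 2)
   (D ^+ 2).
Proof.
case=> k1e hX1 hZ1 hP1 [k2e hX2 hZ2 hP2] D.
set X' := (X in mult_polys _ _ X _).
have lt n m a p : (n < m)%N -> top_coef n a p ->
  top_coef m 0 p by apply: top_coefW.
have c12 : (k.+1 ^ 2)%:R = (k ^ 2)%:R + 2 * k%:R + 1 :> K.
  by rewrite !natrX -addn1 natrD; ring.
have c2k : (k.*2.+1)%:R = 2 * k%:R + 1 :> K.
  by rewrite -addn1 natrD -mul2n natrM.
have hD : top_coef (e1 + e2 + 1) (k.*2.+1)%:R D.
  apply: top_coef_eq (top_coefB (top_coefM hX1 hZ2)
    (top_coef_eq (top_coefM hX2 hZ1) _ (erefl _))) _ _; [lia | lia |].
  by rewrite c12 c2k; ring.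
have hX1Z2 : top_coef (e1 + e2 + 1) ((k ^ 2)%:R + (k.+1 ^ 2)%:R)
    (X1 * Z2 + X2 * Z1).
  apply: top_coef_eq (top_coefD (top_coefM hX1 hZ2)
    (top_coef_eq (top_coefM hX2 hZ1) _ (erefl _))) _ _; [lia | lia |].
  by ring.
split=> //.
- by rewrite -addn1 -mul2n; move: k1e k2e; rewrite -addn1; lia.
(* The leading coefficient is 2 (k^2 + (k + 1)^2) - (2 k + 1)^2 = 1. *)
- have h0 := top_coefZ 2 (top_coefM (top_coefM hX1 hX2) hX1Z2).
  have h1 : top_coef (e1.+1 + e2.+1 + (e1 + e2 + 1)) 0 (b2 * (X1 * X2 * Z1 *
    Z2)).
    by apply: lt (top_coefZ _ (top_coefM (top_coefM (top_coefM hX1 hX2) hZ1)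
      hZ2)); lia.
  have h2 : top_coef (e1.+1 + e2.+1 + (e1 + e2 + 1)) 0
      (b4 * ((X1 * Z2 + X2 * Z1) * Z1 * Z2)).
    by apply: lt (top_coefZ _ (top_coefM (top_coefM hX1Z2 hZ1) hZ2)); lia.
  have h3 : top_coef (e1.+1 + e2.+1 + (e1 + e2 + 1)) 0 (b6 * (Z1 ^+ 2 * Z2 ^+
    2)).
    apply: lt (top_coefZ _ (top_coefM (top_coefXn 2 hZ1) (top_coefXn 2 hZ2)));
      lia.
  apply: top_coef_eq (top_coefB (top_coefD (top_coefD (top_coefD h0 h1) h2) h3)
    (top_coef_eq (top_coefM (top_coefX _) (top_coefXn 2 hD)) _ (erefl _))) _ _.
  + by lia.
  + by lia.
  + by rewrite c12 c2k natrX; ring.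
- by apply: top_coef_eq (top_coefXn 2 hD) _ _; rewrite ?natrX.
move=> P x y Pxy nP.
have [|Z1x [y1 kP]] := hP1 P x y Pxy.
  by move=> j j_le; apply: nP; move: j_le; lia.
have k0 : (0 < k)%N by case: (k) k1e.
have [|Z2x [y2 k1P]] := hP2 P x y Pxy.
  by move=> j j_le; apply: nP; move: j_le k0; lia.
set x1 := X1.[x] / Z1.[x] in kP; set x2 := X2.[x] / Z2.[x] in k1P.
have EkP := valP (P *+ k); rewrite kP in EkP.
have Ek1P := valP (P *+ k.+1); rewrite k1P in Ek1P.
(* Equal abscissae would give P = 0 or (2 k + 1) P = 0. *)
have x21 : x2 != x1.
  apply/eqP => x21; case: (same_abscissa Ek1P EkP x21).
    rewrite -k1P -kP => /val_inj/eqP; rewrite mulrS -subr_eq0 addrK.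
    by apply/negP; apply: (nP 1).
  rewrite -k1P -kP -val_pointN => /val_inj/eqP.
  rewrite -subr_eq0 opprK -mulrnDr addSn addnn.
  by apply/negP/nP; rewrite leqnn.
have [x3 [y3 [x4 [y4 [P3 P4 x34]]]]] := ec_add_sub_x Ek1P EkP x21.
have P4E : x4 = x.
  have := val_pointD (P *+ k.+1) (- (P *+ k)).
  by rewrite val_pointN k1P kP P4 mulrS addrK Pxy => -[].
have P3E : val (P *+ k.*2.+1) = Some (x3, y3).
  by rewrite -addnn -addSn mulrnDr val_pointD k1P kP.
have Dx : D.[x] = (x1 - x2) * (Z1.[x] * Z2.[x]).
  by rewrite /D /x1 /x2 !hornerE /=; field; rewrite Z1x Z2x.
have D0 : D.[x] ^+ 2 != 0.
  by rewrite expf_neq0 // Dx !mulf_neq0 // subr_eq0 eq_sym.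
rewrite horner_exp; split=> //; exists y3; rewrite P3E; congr (Some (_, _)).
apply: (mulIf D0); rewrite divfK //.
have -> : x3 = (x3 + x4) - x by rewrite P4E addrK.
have x120 : x2 - x1 != 0 by rewrite subr_eq0.
have -> : X'.[x] = (Z1.[x] * Z2.[x]) ^+ 2 * (2 * x2 * x1 * (x2 + x1)
    + wb2 E * (x2 * x1) + wb4 E * (x2 + x1) + wb6 E) - x * D.[x] ^+ 2.
  rewrite /X' hornerD hornerN hornerM hornerX horner_exp; congr (_ - _).
  by rewrite /b2 /b4 /b6 /wb2 /wb4 /wb6 /x1 /x2 !hornerE /=; field;
    rewrite Z1x Z2x.
by rewrite x34 Dx; field.
Qed.

Lemma mult_polys1 : mult_polys 1 0 'X 1.
Proof.
split=> //; first exact: top_coefX.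
  by rewrite -polyC1; apply: top_coefC.
move=> P x y Pxy _; rewrite mulr1n Pxy !hornerE oner_neq0; split=> //.
by exists y; rewrite invr1 mulr1.
Qed.

Lemma mult_polys_exist m : (0 < m)%N -> exists e X Z, mult_polys m e X Z.
Proof.
elim/ltn_ind: m => m IH m0; case: (ltngtP m 1) => [|m1|->].
- by rewrite ltnNge m0.
- have k0 : (0 < m./2)%N by lia.
  have [|e1 [X1 [Z1 h1]]] := IH m./2 _ k0; first by lia.
  rewrite -[m]odd_double_half; case: (boolP (odd m)) => om;
    rewrite ?add0n ?add1n.
    have [||e2 [X2 [Z2 h2]]] := IH m./2.+1 _ _; [by lia | by [] |].
    by do 3!eexists; apply: mult_polys_odd h1 h2.
  by do 3!eexists; apply: mult_polys_double h1.
- by exists 0, 'X, 1; apply: mult_polys1.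
Qed.

(* When p = 2 k + 1, a point P of order p satisfies k P = - (k + 1) P. *)
Lemma torsion_poly p : prime p -> [pchar K] =i pred0 ->
  exists D : {poly K}, [/\ D != 0, ((size D).-1.*2.+1 < p ^ 3)%N &
    forall P x y, val P = Some (x, y) -> P *+ p = 0 -> root D x].
Proof.
move=> pp /pcharf0P ch0; case: (even_prime pp) => [->|op].
  (* For p = 2 this is (2 y + a1 x + a3)^2 as a cubic in x; the bound reads 7 < 8. *)
  exists (4%:P * 'X ^+ 3 + b2 * 'X ^+ 2 + b4 * (2%:P * 'X) + b6).
  have [sD cD] : top_coef 3 4 (4%:P * 'X ^+ 3 + b2 * 'X ^+ 2 + b4 * (2%:P * 'X)
    + b6).
    have hX := top_coefX K.
    have h1 := top_coefZ 4 (top_coefXn 3 hX).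
    have h2 : top_coef 3 0 (b2 * 'X ^+ 2).
      by apply: top_coefW (top_coefZ _ (top_coefXn 2 hX)).
    have h3 : top_coef 3 0 (b4 * (2%:P * 'X)).
      by apply: top_coefW (top_coefZ _ (top_coefZ _ hX)).
    have h4 : top_coef 3 0 b6 by apply: top_coefW (top_coefC _).
    apply: top_coef_eq (top_coefD (top_coefD (top_coefD h1 h2) h3) h4) _ _ =>
      //.
    by rewrite expr1n; ring.
  split=> [||P x y Pxy P2].
  - by apply/eqP => D0; move/eqP: cD; rewrite D0 coef0 eq_sym ch0.
  - by move: (size _) sD => s; lia.
  have EP := valP P; rewrite Pxy in EP.
  have : (2 * y + wa1 E * x + wa3 E) ^+ 2 = 0.
    apply/eqP; rewrite expf_eq0 /=.
    move: P2; rewrite mulr2n => /val_point_eq0;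
      rewrite val_pointD Pxy /= eqxx /=.
    by case: ifP => // /eqP <- _; apply/eqP; ring.
  rewrite (two_torsion_x EP) => e0; apply/rootP; rewrite -[RHS]e0.
  by rewrite /b2 /b4 /b6 /wb2 /wb4 /wb6 !hornerE /=; ring.
have pE : p = p./2.*2.+1 by rewrite -[LHS]odd_double_half op.
set k := p./2 in pE; have k0 : (0 < k)%N by have := prime_gt1 pp; lia.
have [e1 [X1 [Z1 [k1e hX1 hZ1 hP1]]]] := mult_polys_exist k0.
have [e2 [X2 [Z2 [k2e hX2 hZ2 hP2]]]] := mult_polys_exist (ltn0Sn k).
exists (X1 * Z2 - X2 * Z1).
(* The leading coefficient (k + 1)^2 - k^2 = p is nonzero in characteristic 0. *)
have [sD cD] : top_coef (e1 + e2 + 1) p%:R (X1 * Z2 - X2 * Z1).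
  apply: top_coef_eq (top_coefB (top_coefM hX1 hZ2)
    (top_coef_eq (top_coefM hX2 hZ1) _ (erefl _))) _ _; [lia | lia |].
  by rewrite pE !natrX -addn1 -(addn1 k.*2) !natrD -mul2n natrM; ring.
split.
- apply/eqP => D0; move/eqP: cD; rewrite D0 coef0 eq_sym ch0.
  by rewrite (negPf (lt0n_neq0 (prime_gt0 pp))).
(* Since e1 + e2 + 1 = (p^2 - 1) / 2, the bound reads p^2 < p^3. *)
- have : ((size (X1 * Z2 - X2 * Z1)%R).-1 <= e1 + e2 + 1)%N.
    by move: (size _) sD => s; lia.
  move: (size _) => s; rewrite pE; move: k1e k2e; nia.
move=> P x y Pxy Pp.
have P0 : P != 0 by apply/eqP => P0; rewrite P0 in Pxy.
have nP j : (0 < j < p)%N -> P *+ j != 0.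
  case/andP=> j0 jp; apply: contra P0 => /eqP Pj.
  have cpj : coprime p j by rewrite prime_coprime // gtnNdvd.
  by have [k' <-] := mulrn_coprimeK cpj Pp; rewrite Pj mul0rn.
have [|Z1x [y1 kP]] := hP1 P x y Pxy.
  by move=> j j_le; apply: nP; lia.
have [|Z2x [y2 k1P]] := hP2 P x y Pxy.
  by move=> j j_le; apply: nP; lia.
have : val (P *+ k.+1) = ec_opp E (val (P *+ k)).
  rewrite -val_pointN; congr val; apply/eqP; rewrite -subr_eq0 opprK -mulrnDr.
  by rewrite addSn addnn -pE Pp.
rewrite kP k1P /= => -[x12 _]; apply/rootP; rewrite !hornerE /=.
have -> : X1.[x] = X1.[x] / Z1.[x] * Z1.[x] by rewrite divfK.
by rewrite -x12; field.
Qed.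

End MultiplicationPolynomials.

(** * Linear dependence of three p-torsion points *)

Section TorsionBound.

Variables (K : fieldType) (E : weierstrass K) (ellE : elliptic E).
Implicit Types (P Q : ec_point ellE).

(** Each root carries at most two points, opposite to each other, and infinity adds one. *)
Lemma size_points_roots (D : {poly K}) (s : seq (ec_point ellE)) :
    D != 0 -> uniq s ->
    (forall P x y, P \in s -> val P = Some (x, y) -> root D x) ->
  (size s <= (size D).-1.*2.+1)%N.
Proof.
move=> D0 s_uniq sD; pose t := pmap val s; pose r := undup (unzip1 t).
have tE x y : (x, y) \in t -> exists2 P, P \in s & val P = Some (x, y).
  by rewrite mem_pmap => /mapP[P Ps ->]; exists P.
have sr : (size r < size D)%N.
  apply: max_poly_roots => //; last by rewrite undup_uniq.
  apply/allP => x; rewrite mem_undup => /mapP[[x' y] /tE[P Ps Pxy] ->].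
  exact: sD Pxy.
(* The ordinate of the first point of [s] above x; any other point of [s] above x is its
   opposite. *)
pose y0 x := (nth (0, 0) t (index x (unzip1 t))).2.
pose l := None :: [seq Some (x, y0 x) | x <- r]
          ++ [seq ec_opp E (Some (x, y0 x)) | x <- r].
have : (size [seq val P | P <- s] <= size l)%N.
  apply: uniq_leq_size; first by rewrite map_inj_uniq //; apply: val_inj.
  move=> _ /mapP[P Ps ->]; rewrite inE mem_cat.
  case Pxy : (val P) => [[x y]|] //=.
  have xt : x \in unzip1 t.
    by apply/mapP; exists (x, y); rewrite // mem_pmap; apply/mapP; exists P.
  have xr : x \in r by rewrite mem_undup.
  have /tE[Q Qs Qxy] : (x, y0 x) \in t.
    have it : (index x (unzip1 t) < size t)%N.
      by rewrite -(size_map fst t) index_mem.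
    have <- : nth (0, 0) t (index x (unzip1 t)) = (x, y0 x).
      rewrite [LHS]surjective_pairing; congr pair.
      by rewrite -(nth_map _ 0 fst it) nth_index.
    exact: mem_nth.
  have EP := valP P; have EQ := valP Q; rewrite Pxy Qxy in EP EQ.
  case: (same_abscissa EP EQ (erefl _)) => ->; apply/orP; [left | right].
    by apply/mapP; exists x.
  by apply/mapP; exists x.
rewrite size_map /l /= size_cat !size_map addnn => /leq_trans; apply.
by rewrite ltnS leq_double -ltnS prednK // (leq_ltn_trans _ sr).
Qed.

(** Pigeonhole: there are p^3 choices of coefficients below p but fewer than p^3 points killed by p,
    so two combinations coincide and their difference is the relation. *)
Lemma torsion_dependent p (u v w : ec_point ellE) :
    prime p -> [pchar K] =i pred0 -> u *+ p = 0 -> v *+ p = 0 -> w *+ p = 0 ->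
  exists a b c, ~~ [&& p %| a, p %| b & p %| c]%N /\
    u *+ a + v *+ b + w *+ c = 0.
Proof.
move=> pp ch0 up vp wp; have [D [D0 sD Dp]] := torsion_poly ellE pp ch0.
pose f (z : 'I_p * 'I_p * 'I_p) := u *+ z.1.1 + v *+ z.1.2 + w *+ z.2.
have /injectivePn[[[a b] c] [[[a' b'] c'] neq]] : ~~ injectiveb f.
  apply/negP => f_uniq.
  have := @size_points_roots D _ D0 f_uniq; rewrite size_map -cardE.
  rewrite !card_prod !card_ord leqNgt => /(_ _)/negP; apply.
    move=> P x y /mapP[z _ ->] /Dp; apply; rewrite /f !mulrnDl.
    by rewrite -!mulrnA !(mulnC _ p) !mulrnA up vp wp !mul0rn !addr0.
  by apply: leq_trans sD _; lia.
(* Coefficients are natural numbers, so p - a' stands for - a'. *)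
rewrite /f /= => e; exists (a + (p - a'))%N, (b + (p - b'))%N, (c + (p - c'))%N.
split.
  apply: contra neq => /and3P[pa pb pc].
  have modE (i j : 'I_p) : (p %| i + (p - j))%N -> i = j.
    case/dvdnP=> q; move: (ltn_ord i) (ltn_ord j) => ip jp qE;
      apply: val_inj => /=.
    move: (nat_of_ord i) (nat_of_ord j) ip jp qE => m k mp kp {sD}.
    by case: q => [|[|q]]; rewrite !(mul0n, mulSn);
      [lia | lia | move: (q * p)%N; lia].
  by rewrite (modE _ _ pa) (modE _ _ pb) (modE _ _ pc).
have mulnB (x : ec_point ellE) (j : 'I_p) : x *+ p = 0 ->
  x *+ (p - j) = - (x *+ j).
  by move=> xp; rewrite mulrnBr ?xp ?sub0r // ltnW.
rewrite !mulrnDr !mulnB //.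
have -> : forall x y z x' y' z' : ec_point ellE,
    (x - x') + (y - y') + (z - z') = x + y + z - (x' + y' + z').
  by move=> x y z x' y' z'; rewrite !opprD [RHS]addrACA (addrACA x).
by rewrite e subrr.
Qed.

End TorsionBound.

(** * Abelian groups of rank two and matrices *)

Section RankTwoTorsion.

Variables (M : zmodType) (p n : nat) (P : M).
Hypotheses (p_prime : prime p) (n_gt0 : (0 < n)%N).
Hypothesis P_torsion : P *+ p ^ n = 0.
Hypothesis P_order : forall k, (0 < k < p ^ n)%N -> P *+ k <> 0.
Hypothesis rank_le2 : forall u v w : M, u *+ p = 0 -> v *+ p = 0 ->
  w *+ p = 0 ->
  exists a b c, ~~ [&& p %| a, p %| b & p %| c]%N /\
    u *+ a + v *+ b + w *+ c = 0.

Let cyc x := exists c : int, x = P *~ c.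

Lemma cycD x y : cyc x -> cyc y -> cyc (x + y).
Proof. by move=> [c ->] [d ->]; exists (c + d); rewrite mulrzDr. Qed.

Lemma cycN x : cyc x -> cyc (- x).
Proof. by move=> [c ->]; exists (- c); rewrite mulrNz. Qed.

Lemma cycMz x (c : int) : cyc x -> cyc (x *~ c).
Proof. by move=> [d ->]; exists (d * c); rewrite -mulrzA. Qed.

Lemma cycMn x (k : nat) : cyc x -> cyc (x *+ k).
Proof. by rewrite pmulrn; apply: cycMz. Qed.

Lemma cycDl x y : cyc y -> cyc (x + y) -> cyc x.
Proof. by move=> cy cxy; rewrite -[x](addrK y); apply/cycD/cycN. Qed.

Lemma mulrn_order_dvdn k : P *+ k = 0 -> (p ^ n %| k)%N.
Proof.
move=> Pk; rewrite /dvdn; apply/negPn/negP; rewrite -lt0n => k0.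
apply: (P_order (k := (k %% p ^ n)%N)).
  by rewrite k0 ltn_mod expn_gt0 prime_gt0.
by move: Pk; rewrite {1}(divn_eq k (p ^ n)) mulrnDr mulnC mulrnA P_torsion
  mul0rn add0r.
Qed.

Lemma coprime_cyc x (b : nat) : x *+ p = 0 -> ~~ (p %| b)%N ->
  cyc (x *+ b) -> cyc x.
Proof.
rewrite -prime_coprime // => xp pb cxb; have [k <-] := mulrn_coprimeK pb xp.
exact: cycMn.
Qed.

(* P has maximal order p ^ n, so a point with a multiple in <P> can be moved
   by an element of <P> to a p-torsion point. *)
Lemma cyc_adjust u : u *+ p ^ n = 0 -> cyc (u *+ p) ->
  exists2 x, cyc x & (u - x) *+ p = 0.
Proof.
move=> un [c uc]; have : P *+ (`|c|%N * p ^ n.-1) = 0.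
  have : u *+ p *+ p ^ n.-1 = 0 by rewrite -mulrnA -expnS prednK.
  rewrite uc => e; rewrite mulrnA; move: e; case: c {uc} => [m|m] //=.
  by rewrite NegzE mulrNz mulNrn => /eqP; rewrite oppr_eq0 => /eqP.
move/mulrn_order_dvdn;
  rewrite -{1}(prednK n_gt0) expnS dvdn_pmul2r ?expn_gt0 ?prime_gt0 //.
move=> pc; have /dvdzP[d cE] : (p %| c)%Z by [].
exists (P *~ d); first by exists d.
by rewrite mulrnBl uc cE mulrzA subrr.
Qed.

(** Shift [u] and [v] by elements of <P> to p-torsion points and relate these to p^(n-1) P. If p
    divided the coefficient of u, either v would lie in <P> or the order of P would be too small; so
    that coefficient can be inverted. *)
Lemma cyc_socle u v : u *+ p ^ n = 0 -> v *+ p ^ n = 0 ->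
    cyc (u *+ p) -> cyc (v *+ p) -> ~ cyc v ->
  exists s : int, cyc (u - v *~ s).
Proof.
move=> un vn up vp nv.
have [x cx ux] := cyc_adjust un up; have [y cy vy] := cyc_adjust vn vp.
have Tp : P *+ p ^ n.-1 *+ p = 0 by rewrite -mulrnA -expnSr prednK.
have cT c : cyc (P *+ p ^ n.-1 *+ c).
  by rewrite -mulrnA pmulrn; exists (p ^ n.-1 * c)%N.
have [a [b [c [abc e]]]] := rank_le2 ux vy Tp.
have pdvd (z : M) k : z *+ p = 0 -> (p %| k)%N -> z *+ k = 0.
  by move=> zp /dvdnP[q ->]; rewrite mulnC mulrnA zp mul0rn.
case: (boolP (p %| a)%N) abc => [pa|pa _].
  case: (boolP (p %| b)%N) => [pb|pb _].
    rewrite /= => pc; case/negP: pc.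
    move: e; rewrite (pdvd _ a) // (pdvd _ b) // !add0r -mulrnA.
    move/mulrn_order_dvdn; rewrite -{1}(prednK n_gt0) expnSr dvdn_pmul2l //.
    by rewrite expn_gt0 prime_gt0.
  case: nv; rewrite -[v](subrK y); apply: cycD => //.
  apply: coprime_cyc vy pb _; apply: cycDl (cT c) _.
  by move: e; rewrite (pdvd _ a) // add0r => ->; exists 0.
have cpa : coprime p a by rewrite prime_coprime.
have [k uE] := mulrn_coprimeK cpa ux.
exists (- (b * k)%:Z).
rewrite mulrNz opprK -[u](subrK x) -addrA (addrC x) addrA; apply: cycD => //.
rewrite -{1}uE -pmulrn mulrnA -mulrnDl; apply: cycMn.
apply: (cycDl (y := - (y *+ b) + P *+ p ^ n.-1 *+ c)).
  by apply: cycD => //; apply/cycN/cycMn.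
by rewrite addrA -(addrA _ _ (- _)) -mulrnBl e; exists 0.
Qed.

(** Take e of maximal order p^(j+1) modulo <P> in the p^n-torsion. If p^(i+1) b lies in <P>,
    [cyc_socle] for p^i b and p^j e shows that subtracting a multiple of e from b brings p^i b into
    <P>; induct on i. *)
Lemma torsion_generated : exists2 e : M, e *+ p ^ n = 0 &
  forall b, b *+ p ^ n = 0 -> exists d : int, cyc (b - e *~ d).
Proof.
pose A j := `[< forall x, x *+ p ^ n = 0 -> cyc (x *+ p ^ j) >].
have exA : exists j, A j by exists n; apply/asboolP => x ->; exists 0.
case: (ex_minnP exA) => -[|j] /asboolP Aj minj.
  by exists 0 => [|b /Aj]; [rewrite mul0rn | exists 0; rewrite mul0rz subr0].
have /asboolPn : ~~ A j by apply/negP => /minj; rewrite ltnn.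
move/existsNP => [e /not_implyP[en ne]]; exists e => // b bn.
have : exists2 i, (i <= j.+1)%N & cyc (b *+ p ^ i) by exists j.+1 => //;
  apply: Aj.
case=> i; elim: i b bn => [|i IH] b bn ij cb.
  by exists 0; rewrite mulr0z subr0 -[b]mulr1n.
have tors (z : M) k : z *+ p ^ n = 0 -> z *+ k *+ p ^ n = 0.
  by move=> zn; rewrite mulrnAC zn mul0rn.
have torsz (z : M) (k : int) : z *+ p ^ n = 0 -> z *~ k *+ p ^ n = 0.
  by move=> zn; rewrite pmulrn mulrzAC -pmulrn zn mul0rz.
have [s cs] : exists s : int, cyc (b *+ p ^ i - e *+ p ^ j *~ s).
  by apply: cyc_socle; rewrite ?tors // -mulrnA -expnSr //; apply: Aj.
(* Chosen so that p^i t = p^j s. *)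
pose t : int := s * (p ^ (j - i))%N%:Z.
have [||d cd] := IH (b - e *~ t) _ (ltnW ij).
- by rewrite mulrnBl bn torsz // subr0.
- rewrite mulrnBl; congr cyc : cs; congr (_ - _); rewrite !pmulrn -!mulrzA /t.
  by rewrite -mulrA -PoszM -expnD subnK 1?mulrC // -ltnS.
by exists (t + d); rewrite mulrzDr opprD addrA.
Qed.

(** If p divides d, then p^(k+1) e in <P> puts s (p^k e), hence p^k e, in <P>. Descending from p^n e
    = 0 gives e in <P>; then s fixes e, and c = 0, d = 1 serve instead. *)
Lemma automorphism_coef e (s : {additive M -> M}) : injective s -> s P = P ->
    e *+ p ^ n = 0 -> (forall b, b *+ p ^ n = 0 ->
      exists d : int, cyc (b - e *~ d)) ->
  exists c d : int, s e = P *~ c + e *~ d /\ coprime p `|d|%N.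
Proof.
move=> s_inj sP en gen; have scyc x : cyc (s x) -> cyc x.
  move=> [c sx]; exists c; apply: s_inj; rewrite sx raddfMz sP //.
have [d [c sE]] : exists d : int, cyc (s e - e *~ d).
  by apply: gen; rewrite -raddfMn en raddf0.
case: (boolP (p %| `|d|%N)%N) => pd; last first.
  by exists c, d; rewrite prime_coprime // -sE subrK.
have [c' eE] : cyc e.
  have : cyc (e *+ p ^ n) by rewrite en; exists 0.
  elim: (n) => [|k IH] ce; first by rewrite -[e]mulr1n.
  apply: IH; apply: scyc; rewrite raddfMn -[s e](subrK (e *~ d)) sE mulrnDl.
  apply: cycD; first by apply: cycMn; exists c.
  have /dvdzP[q ->] : (p %| d)%Z by [].
  rewrite pmulrn -!mulrzA -mulrA -PoszM -expnS mulrC mulrzA -pmulrn.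
  exact: cycMz.
by exists 0, 1; rewrite mulr0z add0r mulr1z coprimen1 {1}eE raddfMz sP.
Qed.

End RankTwoTorsion.

Section ScalingByZq.

Variables (M : zmodType) (q : nat).
Hypothesis q_gt1 : (1 < q)%N.

(** Total on M through the representative of [a] below q; the module laws are stated for elements
    killed by q. *)
Definition zscale (a : 'Z_q) (x : M) : M := x *+ (a : nat).

Lemma mulrn_modq (x : M) k : x *+ q = 0 -> x *+ (k %% q) = x *+ k.
Proof.
move=> xq; rewrite [in RHS](divn_eq k q) mulrnDr mulnC mulrnA xq mul0rn.
by rewrite add0r.
Qed.

Lemma zscale_nat (x : M) k : x *+ q = 0 -> zscale k%:R x = x *+ k.
Proof. by move=> xq; rewrite /zscale val_Zp_nat // mulrn_modq. Qed.

Lemma zscale_int (x : M) (c : int) : x *+ q = 0 -> zscale c%:~R x = x *~ c.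
Proof.
move=> xq; case: c => k; first by rewrite zscale_nat.
rewrite NegzE !mulrNz -pmulrn; have q0 : (0 < q)%N by apply: ltnW.
(* Writing -1 as q - 1 turns the scalar into a natural number. *)
have -> : - (k.+1%:~R : 'Z_q) = (k.+1 * q.-1)%:R.
  apply/eqP; rewrite eq_sym -addr_eq0 -pmulrn -natrD -mulnSr prednK //.
  by rewrite natrM pchar_Zp // mulr0.
rewrite zscale_nat //; apply/eqP; rewrite -addr_eq0 -mulrnDr -mulnSr prednK //.
by rewrite mulnC mulrnA xq mul0rn.
Qed.

Lemma zscaleDl (a b : 'Z_q) x :
  x *+ q = 0 -> zscale (a + b) x = zscale a x + zscale b x.
Proof.
by move=> xq; rewrite -[a in LHS]natr_Zp -[b in LHS]natr_Zp -natrD zscale_nat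
  // mulrnDr.
Qed.

Lemma zscaleA (a b : 'Z_q) x : x *+ q = 0 ->
  zscale (a * b) x = zscale a (zscale b x).
Proof.
move=> xq; rewrite -[a in LHS]natr_Zp -[b in LHS]natr_Zp -natrM zscale_nat //.
by rewrite mulnC mulrnA.
Qed.

Lemma zscale0 x : zscale 0 x = 0. Proof. by []. Qed.

Lemma zscale1 x : x *+ q = 0 -> zscale 1 x = x.
Proof. by move=> xq; rewrite -[1]/(1%:R) zscale_nat. Qed.

Lemma zscale_suml (I : Type) (r : seq I) (F : I -> 'Z_q) x : x *+ q = 0 ->
  zscale (\sum_(i <- r) F i) x = \sum_(i <- r) zscale (F i) x.
Proof.
move=> xq; elim/big_rec2: _ => [|i y a _ <-]; first exact: zscale0.
exact: zscaleDl.
Qed.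

Lemma zscale_sumr (I : Type) (r : seq I) (F : I -> M) a :
  zscale a (\sum_(i <- r) F i) = \sum_(i <- r) zscale a (F i).
Proof. by rewrite /zscale sumrMnl. Qed.

Lemma zscale_additive (s : {additive M ->
  M}) a x : s (zscale a x) = zscale a (s x).
Proof. exact: raddfMn. Qed.

End ScalingByZq.

(** * From a faithful action to a subquotient of GL_2 *)

Section QuotientOfGL2.

Variables (M : zmodType) (p n : nat) (P : M).
Hypotheses (p_prime : prime p) (n_gt0 : (0 < n)%N).
Hypothesis P_torsion : P *+ p ^ n = 0.
Hypothesis P_order : forall k, (0 < k < p ^ n)%N -> P *+ k <> 0.
Hypothesis rank_le2 : forall u v w : M, u *+ p = 0 -> v *+ p = 0 ->
  w *+ p = 0 ->
  exists a b c, ~~ [&& p %| a, p %| b & p %| c]%N /\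
    u *+ a + v *+ b + w *+ c = 0.

Variables (gT : finGroupType) (act : gT -> {additive M -> M}).
Hypothesis act1 : forall x, act 1%g x = x.
Hypothesis actM : forall s t x, act (s * t)%g x = act t (act s x).
Hypothesis act_fix : forall s, act s P = P.
Hypothesis act_faithful :
  forall s, (forall x, x *+ p ^ n = 0 -> act s x = x) -> s = 1%g.

Let q := (p ^ n)%N.

Lemma expn_prime_gt1 : (1 < q)%N.
Proof. by rewrite /q -(exp1n n) ltn_exp2r // prime_gt1. Qed.

(** The generators [P] and [e2] may satisfy relations, so an element of G can have several matrices;
    but a matrix determines its element, by faithfulness. Hence the map goes from the group of
    matrices representing elements of G onto G. *)
Lemma quotient_of_GL2 (G : {group gT}) :
  exists H N : {group {'GL_2['Z_(p ^ n)]}}, (N <| H)%g /\ (G \isog H / N)%g.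
Proof.
have [e2 e2q gen] := torsion_generated p_prime n_gt0 P_torsion P_order rank_le2.
pose e (i : 'I_2) := if i == 0 then P else e2.
have eq0 i : e i *+ q = 0 by rewrite /e; case: ifP.
(* Row i expresses the image of [e i]; as [act (s * t)] applies [s] first, products keep their
   order. *)
pose rep (A : 'M['Z_q]_2) s := [forall i, act s (e i) == \sum_j zscale (A i j)
  (e j)].
have repM A B s t : rep A s -> rep B t -> rep (A *m B) (s * t)%g.
  move=> /forallP rA /forallP rB; apply/forallP => i; apply/eqP.
  rewrite actM (eqP (rA i)) raddf_sum.
  under eq_bigr => k _ do rewrite zscale_additive (eqP (rB k)) zscale_sumr.
  rewrite exchange_big; apply: eq_bigr => j _;
    rewrite mxE zscale_suml ?expn_prime_gt1 //.
  by apply: eq_bigr => k _; rewrite zscaleA ?expn_prime_gt1.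
have rep1 : rep 1%:M 1%g.
  apply/forallP => i; apply/eqP; rewrite act1 (bigD1 i) //= mxE eqxx.
  rewrite zscale1 ?expn_prime_gt1 // big1 ?addr0 // => j ji.
  by rewrite mxE eq_sym (negPf ji).
have actK s : cancel (act s) (act s^-1%g) by move=> x; rewrite -actM mulgV act1.
have rep_inj A s t : rep A s -> rep A t -> s = t.
  move=> /forallP rs /forallP rt; apply/eqP; rewrite eq_mulgV1; apply/eqP.
  have fixe i : act (s * t^-1)%g (e i) = e i.
    by rewrite actM (eqP (rs i)) -(eqP (rt i)) actK.
  apply: act_faithful => x /gen[d [c xE]]; rewrite -[x](subrK (e2 *~ d)) xE.
  by rewrite raddfD !raddfMz act_fix (fixe 1).
have rep_ex s : exists u : {'GL_2['Z_(p ^ n)]}, rep (GLval u) s.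
  have [c [d [sE pd]]] := automorphism_coef p_prime (can_inj (actK s)) (act_fix
    s) e2q gen.
  (* The rows are (1, 0), because P is fixed, and (c, d); the determinant d is prime to p. *)
  pose A : 'M['Z_q]_2 := \matrix_(i, j)
    if i == 0 then (j == 0)%:R else if j == 0 then c%:~R else d%:~R.
  have uA : A \is a GRing.unit.
    rewrite -[_ \is a _]/(A \in unitmx) unitmxE det_trig; last first.
      by apply/is_trig_mxP => i j; rewrite mxE;
        case: (i) (j) => [[|[|?]] ?] [[|[|?]] ?].
    rewrite big_ord_recl big_ord1 !mxE /= mul1r.
    have unitn k : coprime p k -> (k%:R : 'Z_q) \is a GRing.unit.
      by move=> pk; rewrite unitZpE ?expn_prime_gt1 // coprime_pexpl.
    case: d {A sE} pd => k pk; first exact: unitn.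
    by rewrite NegzE mulrNz unitrN; apply: unitn.
  exists (Sub A uA); apply/forallP => i; apply/eqP.
  rewrite -[GLval _]/A big_ord_recl big_ord1 !mxE /= /e /=.
  case: ifP => _; first by rewrite act_fix zscale1 ?expn_prime_gt1 // zscale0
    addr0.
  by rewrite !zscale_int ?expn_prime_gt1.
pose H := [set u : {'GL_2['Z_(p ^ n)]} | [exists s in G, rep (GLval u) s]].
(* The default 1 is taken only outside H. *)
pose f (u : {'GL_2['Z_(p ^ n)]}) := odflt 1%g [pick s in G | rep (GLval u) s].
have fP (u : {'GL_2['Z_(p ^ n)]}) : u \in H -> f u \in G /\ rep (GLval u) (f u).
  rewrite inE /f => /exists_inP[s Gs us]; case: pickP => [t /andP[]//|/(_ s)].
  by rewrite Gs us.
have fE (u : {'GL_2['Z_(p ^ n)]}) s : s \in G -> rep (GLval u) s -> f u = s.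
  move=> Gs us; have /fP[_ fu] : u \in H by rewrite inE; apply/exists_inP;
    exists s.
  exact: rep_inj fu us.
have HG : group_set H.
  apply/group_setP; split=> [|u v /fP[Gu ru] /fP[Gv rv]].
    by rewrite inE; apply/exists_inP; exists 1%g; rewrite ?group1.
  rewrite inE; apply/exists_inP; exists (f u * f v)%g; rewrite ?groupM //.
  exact: repM.
have fM : {in Group HG &, {morph f : u v / (u * v)%g}}.
  move=> u v /fP[Gu ru] /fP[Gv rv]; apply: fE; rewrite ?groupM //.
  exact: repM.
pose phi := Morphism fM.
exists (Group HG), ('ker phi)%G; split; first exact: ker_normal.
rewrite isog_sym.
suff <- : (phi @* Group HG)%g = G by apply: first_isog.
apply/setP => s; apply/morphimP/idP => [[u _ /fP[Gu _] -> //]|Gs].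
have [u us] := rep_ex s; exists u; last by rewrite /= (fE u s).
  by rewrite inE; apply/exists_inP; exists s.
by rewrite inE; apply/exists_inP; exists s.
Qed.

End QuotientOfGL2.

(** * Galois action *)

Section BaseChange.

Variables (K K' : fieldType) (f : {rmorphism K -> K'}) (E : weierstrass K).
Implicit Types P Q : option (K * K).

Definition map_point P : option (K' * K') :=
  omap (fun z => (f z.1, f z.2)) P.

Lemma map_point_inj : injective map_point.
Proof. by case=> [[x y]|] [[x' y']|] //= [/fmorph_inj -> /fmorph_inj ->]. Qed.

Lemma on_curve_map P : on_curve (map_weierstrass f E) (map_point P) = on_curve
  E P.
Proof.
case: P => [[x y]|] //=.
by rewrite -!rmorphXn -!rmorphM -!rmorphD (inj_eq (fmorph_inj f)).
Qed.

Lemma elliptic_map : elliptic (map_weierstrass f E) = elliptic E.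
Proof.
rewrite /elliptic -[in RHS](inj_eq (fmorph_inj f)) rmorph0; congr (_ != _).
by rewrite /discriminant /=; ring.
Qed.

Lemma ec_add_map P Q :
  ec_add (map_weierstrass f E) (map_point P) (map_point Q)
    = map_point (ec_add E P Q).
Proof.
case: P Q => [[x1 y1]|] [[x2 y2]|] //=.
rewrite (inj_eq (fmorph_inj f)).
rewrite -[f y1 + f y2 + _ + _](_ : f (y1 + y2 + wa1 E * x2 + wa3 E) = _);
  last by ring.
rewrite fmorph_eq0; case: ifP => // _; rewrite /map_point /=.
set l' := if _ then _ else _; set l := if _ then _ else _.
have -> : l' = f l.
  by rewrite /l' /l; case: ifP => _; rewrite fmorph_div; congr (_ / _); ring.
by congr (Some (_, _)); ring.
Qed.

Lemma ec_mul_map k P :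
  ec_mul (map_weierstrass f E) k (map_point P) = map_point (ec_mul E k P).
Proof. by elim: k => //= k ->; rewrite ec_add_map. Qed.

End BaseChange.

Section GaloisAction.

Variables (F : fieldType) (N : splittingFieldType F) (E : weierstrass F).
Let EN := map_weierstrass (GRing.in_alg N) E.
Variable ellEN : elliptic EN.
Local Notation points := (ec_point ellEN).
Local Notation gal := (gal_of {:N}).
Implicit Types (s t : gal) (P : points).

Lemma gal_weierstrass s : map_weierstrass s EN = EN.
Proof. by rewrite /EN /map_weierstrass /= !rmorph_alg. Qed.

Lemma gal_point_subproof s P : on_curve EN (map_point s (val P)).
Proof. by rewrite -{1}(gal_weierstrass s) on_curve_map (valP P). Qed.

Definition gal_point s P : points := mk_point ellEN (gal_point_subproof s P).

Lemma gal_pointD s : {morph gal_point s : P Q / P + Q}.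
Proof.
move=> P Q; apply: val_inj.
by rewrite val_pointD /= -[RHS]/(ec_add EN _ _) -ec_add_map gal_weierstrass.
Qed.

Fact gal_point_zmod s : zmod_morphism (gal_point s).
Proof. by move=> P Q;
  rewrite -[in RHS](subrK Q P) [in RHS]gal_pointD addrK. Qed.

HB.instance Definition _ s :=
  GRing.isZmodMorphism.Build points points (gal_point s) (gal_point_zmod s).

Lemma gal_pointMn s P k : gal_point s (P *+ k) = gal_point s P *+ k.
Proof. exact: raddfMn. Qed.

Lemma gal_point1 P : gal_point 1%g P = P.
Proof.
apply: val_inj => /=; case: (sval P) => [[x y]|] //=.
by rewrite !gal_id.
Qed.

Lemma gal_pointM s t P : gal_point (s * t)%g P = gal_point t (gal_point s P).
Proof.
apply: val_inj => /=; case: (sval P) => [[x y]|] //=.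
by rewrite !galM ?memvf.
Qed.

Lemma gal_point_base (P0 : option (F * F)) s P :
  val P = map_point (GRing.in_alg N) P0 -> gal_point s P = P.
Proof.
move=> PE; apply: val_inj; rewrite /= -[sval P]/(val P) PE.
by case: (P0) => [[x y]|] //=; rewrite !rmorph_alg.
Qed.

Definition fixer m : {set gal} :=
  [set s | `[< forall P, P *+ m = 0 -> gal_point s P = P >]].

Lemma fixerP m s :
  reflect (forall P, P *+ m = 0 -> gal_point s P = P) (s \in fixer m).
Proof. by rewrite inE; apply: asboolP. Qed.

Lemma fixer_group_set m : group_set (fixer m).
Proof.
apply/group_setP; split=> [|s t /fixerP sP /fixerP tP]; apply/fixerP => P mP.
  exact: gal_point1.
by rewrite gal_pointM sP // tP.
Qed.
Canonical fixer_group m := Group (fixer_group_set m).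

Lemma fixer_norm m (A : {set gal}) : A \subset 'N(fixer m)%g.
Proof.
apply/subsetP => t _; rewrite inE; apply/subsetP => _ /imsetP[s /fixerP sP ->].
apply/fixerP => P mP; rewrite conjgE !gal_pointM sP.
  by rewrite -gal_pointM mulVg gal_point1.
by rewrite -gal_pointMn mP raddf0.
Qed.

Lemma fixerX p n s : (0 < n)%N -> s \in fixer (p ^ n) ->
  (s ^+ p)%g \in fixer (p ^ n.+1).
Proof.
move=> n0 /fixerP sP; apply/fixerP => Q Qn; pose R := gal_point s Q - Q.
have Rp : R *+ p = 0.
  by rewrite /R mulrnBl -gal_pointMn sP ?subrr // -mulrnA -expnS.
(* As 0 < n, the p-torsion point [R] is killed by p^n. *)
have sR : gal_point s R = R.
  by apply: sP; rewrite -(prednK n0) expnS mulrnA Rp mul0rn.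
have sX k : gal_point (s ^+ k)%g Q = Q + R *+ k.
  elim: k => [|k IH]; first by rewrite expg0 gal_point1 mulr0n addr0.
  rewrite expgSr gal_pointM IH gal_pointD gal_pointMn sR mulrS addrA.
  by congr (_ + _); rewrite /R addrC subrK.
by rewrite sX Rp addr0.
Qed.

End GaloisAction.

(** * Normal subgroups of the Galois group of the normal closure *)

Section NormalClosure.

Variables (F : fieldType) (L : fieldExtType F) (N : splittingFieldType F).
Variable iota : 'AHom(L, N).
Hypothesis clN : is_normal_closure iota.
Hypothesis galN : galois 1 {:N}.
Local Notation G := ('Gal({:N} / 1))%G.
Local Notation H := ('Gal({:N} / limg iota))%G.

(** The fixed field of A is normal over F and contains L, hence is all of N. *)
Lemma normal_core_trivial (A : {group gal_of {:N}}) :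
  (A <| G)%g -> A \subset H -> A = 1%g :> {set _}.
Proof.
move=> nA sAH; have /and3P[_ _ nF] := normal_fixedField_galois galN nA.
have sLF : (limg iota <= fixedField A)%VS.
  by rewrite -(galois_connection _ (subvf _)).
have fixE := clN sLF nF.
apply/trivgP/subsetP => s As; rewrite inE; apply/gal_eqP => a _.
have : a \in fixedField A by rewrite fixE memvf.
by case/mem_fixedFieldP => _ /(_ _ As) ->; rewrite gal_id.
Qed.

Lemma index_gal : #|G : H|%g = \dim {:L}.
Proof.
rewrite -divgS ?galS ?sub1v // -!galois_dim //; last first.
  by apply: galoisS galN; rewrite sub1v subvf.
rewrite dimv1 divn1.
have -> : \dim {:L} = \dim (limg iota).
  by rewrite limg_dim_eq // (eqP (AHom_lker0 _)) capv0.
by rewrite divnA ?field_dimS ?subvf // mulKn ?adim_gt0.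
Qed.

(** The index of H is prime to p, so a Sylow p-subgroup of H is one of G and contains every normal
    p-subgroup of G. *)
Lemma normal_pgroup_sub (p : nat) (A : {group gal_of {:N}}) :
  prime p -> coprime p (\dim {:L}) -> (A <| G)%g -> (p.-group A)%g ->
    A \subset H.
Proof.
move=> pp cop nA pA; have [S sylS] := Sylow_exists p H.
have sHG : H \subset G by rewrite galS ?sub1v.
apply: subset_trans (pcore_max pA nA) _.
apply: subset_trans _ (pHall_sub sylS); apply: pcore_sub_Hall.
case/and3P: sylS => sSH pS p'S; apply/and3P; split=> //.
  exact: subset_trans sHG.
rewrite -(Lagrange_index sHG sSH) pnatM p'S andbT index_gal.
by rewrite p'natE // -prime_coprime.
Qed.

End NormalClosure.

Lemma number_field_galois (F : fieldExtType rat) (N : splittingFieldType F) :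
  [pchar N] =i pred0 /\ galois 1 {:N}.
Proof.
have ch0 : [pchar N] =i pred0.
  by move=> q; rewrite pchar_lalg pchar_lalg Num.Theory.pchar_num.
split=> //; rewrite /galois sub1v normalFieldf andbT /=.
by apply/separableP => y _; apply: pcharf0_separable.
Qed.

Theorem theorem4p5 (F : fieldExtType rat) (L : fieldExtType F)
    (Lhat : splittingFieldType F) (iota : 'AHom(L, Lhat))
    (n p : nat) (E : weierstrass F) :
  is_normal_closure iota ->
  (0 < n)%N ->
  prime p ->
  coprime p (\dim {:L}) ->
  (forall H N : {group {'GL_2['Z_(p ^ n)]}},
     (N <| H)%g -> ~~ ('Gal({:Lhat} / 1) \isog (H / N))%g) ->
  maximal 'Gal({:Lhat} / limg iota) 'Gal({:Lhat} / 1) ->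
  elliptic E ->
  has_point_of_order E (p ^ n) ->
  ~ has_point_of_order E (p ^ n.+1) ->
  ~ has_point_of_order (map_weierstrass (GRing.in_alg L) E) (p ^ n.+1).
Proof.
move=> clN n0 pp cop notGL maxH ellE [P0 [EP0 _ P0n P0k]] noF [Q0 [EQ0 _ Q0n
  Q0k]].
have [ch0 galN] := number_field_galois Lhat.
pose EN := map_weierstrass (GRing.in_alg Lhat) E.
have ellEN : elliptic EN by rewrite elliptic_map.
have ENE : map_weierstrass iota (map_weierstrass (GRing.in_alg L) E) = EN.
  by rewrite /EN /map_weierstrass /= !rmorph_alg.
have EP : on_curve EN (map_point (GRing.in_alg Lhat) P0) by rewrite
  on_curve_map.
have EQ : on_curve EN (map_point iota Q0) by rewrite -ENE on_curve_map.
pose P := mk_point ellEN EP; pose Q := mk_point ellEN EQ.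
have Pn : P *+ p ^ n = 0.
  by apply: val_inj; rewrite val_point_mul ec_mul_map P0n.
have Pk k : (0 < k < p ^ n)%N -> P *+ k <> 0.
  move=> km /(congr1 val); rewrite val_point_mul ec_mul_map.
  by case/(@map_point_inj _ _ _ _ None)/(P0k k km).
have mulQ k : ec_mul EN k (map_point iota Q0)
    = map_point iota (ec_mul (map_weierstrass (GRing.in_alg L) E) k Q0).
  by rewrite -ENE ec_mul_map.
have Qn : Q *+ p ^ n.+1 = 0.
  by apply: val_inj; rewrite val_point_mul mulQ Q0n.
set G := 'Gal({:Lhat} / 1)%G in maxH *.
set H := 'Gal({:Lhat} / limg iota)%G in maxH *.
have GT s : s \in G.
  by rewrite gal_kAut ?sub1v // kAut1E limg_gal.
pose stab := [set s : gal_of {:Lhat} | gal_point s Q == Q].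
have stab_group : group_set stab.
  apply/group_setP; split=> [|s t]; rewrite !inE ?gal_point1 //.
  by rewrite gal_pointM => /eqP -> /eqP ->.
have sHstab : H \subset stab.
  apply/subsetP => s Hs; rewrite inE; apply/eqP/val_inj => /=.
  case: (Q0) => [[x y]|] //=.
  by rewrite !(fixed_gal _ Hs) ?subvf ?memv_img ?memvf.
(* If G fixed Q, the coordinates of Q would lie in F and give an F-rational point of order
   p^(n+1). *)
have stab_proper : stab \proper G.
  rewrite properE; apply/andP; split; first by apply/subsetP => s _.
  apply/negP => sG; apply: noF.
  have fixQ s : gal_point s Q = Q.
    by apply/eqP; have := subsetP sG s (GT s); rewrite inE.
  have inF z : (forall s : gal_of {:Lhat}, s z = z) -> exists c : F, z = c%:A.
    have /galois_fixedField fixE := galN.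
    by move=> sz; apply/vlineP; rewrite -[vline _]fixE;
      apply/fixedFieldP => [|s _]; [exact: memvf | exact: sz].
  have [Q1 QE] : exists Q1, map_point iota Q0 = map_point (GRing.in_alg Lhat)
    Q1.
    have valQ (s : gal_of {:Lhat}) : map_point s (map_point iota Q0) =
      map_point iota Q0.
      by have /(congr1 val) := fixQ s.
    case: (Q0) valQ => [[x y]|] /= fixxy; last by exists None.
    have [c ->] : exists c : F, iota x = c%:A by apply: inF => s;
      case: (fixxy s).
    have [d ->] : exists d : F, iota y = d%:A by apply: inF => s;
      case: (fixxy s).
    by exists (Some (c, d)).
  have Q1E k : ec_mul E k Q1 = None <->
      ec_mul (map_weierstrass (GRing.in_alg L) E) k Q0 = None.
    split=> e; first by apply: (@map_point_inj _ _ iota);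
      rewrite -mulQ QE ec_mul_map e.
    by apply: (@map_point_inj _ _ (GRing.in_alg Lhat));
      rewrite -ec_mul_map -QE mulQ e.
  exists Q1; split; rewrite ?expn_gt0 ?prime_gt0 //.
  - by rewrite -(on_curve_map (GRing.in_alg Lhat)) -QE.
  - exact/Q1E.
  - by move=> k km /Q1E; apply: Q0k.
have stabE : stab = H.
  case/maxgroupP: maxH => _ /(_ (Group stab_group) stab_proper sHstab).
  exact: id.
have fixer_normal m : (fixer ellEN m <| G)%g.
  by rewrite /normal fixer_norm andbT; apply/subsetP => s _.
have fixer1 : fixer ellEN (p ^ n.+1) = 1%g.
  apply: (normal_core_trivial clN galN (fixer_normal _)).
  suff : fixer ellEN (p ^ n.+1) \subset stab by rewrite stabE.
  by apply/subsetP => s /fixerP sP; rewrite inE sP.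
(* By Cauchy a prime l dividing the order is the order of some s; since s^p = 1, l equals p. *)
have pfixer : (p.-group (fixer ellEN (p ^ n)))%g.
  apply/pgroupP => l pl /(Cauchy pl)[s sV ls].
  have := fixerX n0 sV; rewrite fixer1 inE -order_dvdn ls.
  by rewrite dvdn_prime2.
have fixer1n : fixer ellEN (p ^ n) = 1%g.
  apply: (normal_core_trivial clN galN (fixer_normal _)).
  exact: normal_pgroup_sub pp cop (fixer_normal _) pfixer.
have rank2 u v w := @torsion_dependent _ _ ellEN p u v w pp ch0.
have [||||GH [GN [nGN isoG]]] := @quotient_of_GL2 _ p n P pp n0 Pn Pk rank2
  _ (fun s => gal_point s : {additive _ -> _}) _ _ _ _ G.
- exact: gal_point1.
- exact: gal_pointM.
- move=> s; exact: gal_point_base.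
- move=> s /fixerP; rewrite fixer1n inE => /eqP //.
by have := notGL _ _ nGN; rewrite isoG.
Qed.
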